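(* There exists an algorithm that, given a positive integer $N$, computes the integer complexity $f(n)$ for all positive integers $n\leq N$ in $O(N\,\mathrm{polylog}\,N)$ time.
   Context: The integer complexity $f(n)$ of a positive integer $n$ is the minimum number of 1's needed to write an arithmetic expression evaluating to $n$ that uses only the constant $1$, addition, multiplication and parentheses. For example $f(6)=5$ since $6=(1+1)\cdot(1+1+1)$. Running times are measured in the standard word-RAM model. *)

(* Defs.v *)
From mathcomp Require Import all_boot.

Set Implicit Arguments.
Unset Strict Implicit.
Unset Printing Implicit Defensive.

(** * Integer complexity *)

Inductive expr : Type :=
| One
| Plus of expr & expr
| Times of expr & expr.

Fixpoint value (e : expr) : nat :=
  match e with
  | One => 1
  | Plus a b => value a + value b
  | Times a b => value a * value b
  end.

Fixpoint ones (e : expr) : nat :=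
  match e with
  | One => 1
  | Plus a b | Times a b => ones a + ones b
  end.

(** [is_complexity n m] reads "f(n) = m". *)
Definition is_complexity (n m : nat) : Prop :=
  (exists2 e, value e = n & ones e = m) /\
  (forall e, value e = n -> m <= ones e).

Lemma is_complexity_uniq n m1 m2 :
  is_complexity n m1 -> is_complexity n m2 -> m1 = m2.
Proof.
move=> [[e1 v1 <-] min1] [[e2 v2 <-] min2].
by apply/eqP; rewrite eqn_leq min1 ?min2.
Qed.

(** * The word RAM

    Words are the naturals below [2 ^ w].  A program is a finite list of
    instructions, so it mentions only finitely many registers; the memory is
    addressed by the contents of registers, i.e. by words. *)

Inductive binop : Type :=
| OpAdd | OpSub | OpMul | OpDiv | OpMod
| OpAnd | OpOr | OpXor
| OpShl | OpShr.

(** Addition, subtraction, multiplication and left shift wrap around modulo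
    [2 ^ w].  Division by zero follows [divn] and [modn]: the quotient is [0]
    and the remainder is the dividend. *)
Definition eval_binop (w : nat) (o : binop) (x y : nat) : nat :=
  match o with
  | OpAdd => (x + y) %% 2 ^ w
  | OpSub => (x + 2 ^ w - y) %% 2 ^ w
  | OpMul => (x * y) %% 2 ^ w
  | OpDiv => x %/ y
  | OpMod => x %% y
  | OpAnd => Nat.land x y
  | OpOr  => Nat.lor x y
  | OpXor => Nat.lxor x y
  | OpShl => (x * 2 ^ y) %% 2 ^ w
  | OpShr => x %/ 2 ^ y
  end.

Definition reg := nat.
Definition label := nat.

Inductive instr : Type :=
| Const of reg & nat              (* r := k mod 2^w *)
| Move of reg & reg               (* r := a *)
| Op of binop & reg & reg & reg   (* r := a op b *)
| Read of reg & reg               (* r := mem[a] *)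
| Write of reg & reg              (* mem[a] := r, address register first *)
| Jump of label
| JumpEq of reg & reg & label     (* if a = b goto l *)
| JumpLt of reg & reg & label     (* if a < b goto l *)
| Halt.

Definition program := seq instr.

Record state : Type := State {
  pc : nat;
  regs : reg -> nat;
  memory : nat -> nat
}.

Definition upd (f : nat -> nat) (a v : nat) : nat -> nat :=
  fun i => if i == a then v else f i.

(** One instruction, at unit cost; [None] when the machine has halted, either
    on [Halt] or because the program counter points outside the program. *)
Definition step (w : nat) (P : program) (s : state) : option state :=
  let: State l R M := s in
  match nth Halt P l with
  | Const r k => Some (State l.+1 (upd R r (k %% 2 ^ w)) M)
  | Move r a => Some (State l.+1 (upd R r (R a)) M)
  | Op o r a b => Some (State l.+1 (upd R r (eval_binop w o (R a) (R b))) M)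
  | Read r a => Some (State l.+1 (upd R r (M (R a))) M)
  | Write a r => Some (State l.+1 R (upd M (R a) (R r)))
  | Jump l' => Some (State l' R M)
  | JumpEq a b l' => Some (State (if R a == R b then l' else l.+1) R M)
  | JumpLt a b l' => Some (State (if R a < R b then l' else l.+1) R M)
  | Halt => None
  end.

(** [exec w P t s s']: started in [s], the machine halts in [s'] after exactly
    [t] instructions. *)
Inductive exec (w : nat) (P : program) : nat -> state -> state -> Prop :=
| exec_halt s : step w P s = None -> exec w P 0 s s
| exec_step t s s1 s2 :
    step w P s = Some s1 -> exec w P t s1 s2 -> exec w P t.+1 s s2.

(** The input is in register [0]; all other registers and the whole memory
    are zero. *)
Definition init (N : nat) : state :=
  State 0 (upd (fun=> 0) 0 N) (fun=> 0).

Definition bit_length (N : nat) : nat := (trunc_log 2 N).+1.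

(** [P] computes f(1), ..., f(N) from [N] in time [T N], leaving f(n) in memory
    cell [n].  As usual, words are assumed to have at least [c] times as many
    bits as the input, for some constant [c]: the same program must work,
    within the same time bound, for every such word size [w].  As [0 < c], the input [N] fits
    in a word. *)
Definition computes_complexities_in (P : program) (T : nat -> nat) : Prop :=
  exists2 c : nat, 0 < c &
    forall N w : nat, 0 < N -> c * bit_length N <= w ->
      exists t s,
        [/\ exec w P t (init N) s,
            t <= T N
          & forall n, 0 < n <= N -> is_complexity n (memory s n)].

(** T(N) = O(N polylog N); [trunc_log 2] is the floor of the binary logarithm,
    which changes the bound only by a constant factor for [2 <= N]. *)
Definition O_N_polylog (T : nat -> nat) : Prop :=
  exists k C N0 : nat, forall N : nat, N0 <= N ->
    T N <= C * (N * trunc_log 2 N ^ k).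

(* Main.v *)
(** Complexities of numbers up to [N] are [O(log N)], so they can be found in
    [O(log N)] stages: the numbers of complexity [m] are the sums and products
    of two numbers whose complexities add up to [m].  Products are enumerated
    directly, as there are [O(N log N)] pairs [a, b] with [a * b <= N].  For the
    sums, each of the [O(log N)] ways to split [m] asks for a sumset, that is,
    for the support of a product of two 0-1 polynomials.

    A word RAM cannot rely on a prime modulus with a large root of unity, so
    the polynomial product is Nussbaumer's: an element of
    [Z[x] / (x ^ (m * r) + 1)] is written as a polynomial of degree less than
    [m <= r] in [x] over [Z[y] / (y ^ r + 1)], [y = x ^ m], and two of these are
    multiplied by a Fourier transform of length [2 * m] whose roots of unity are
    powers of [y], so that it only shifts and adds.  The pointwise products are
    handled in the same way, all at once; taking [m] close to [r] gives
    [O(log log N)] levels, each doubling the data.  Words are read modulo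
    [2 ^ w]; instead of dividing by the lengths of the transforms one
    obtains the product scaled by a power of two, which is enough to see
    which coefficients vanish. *)

Require Import Defs.
From mathcomp Require Import all_boot all_algebra qpoly zify ring.

Set Implicit Arguments.
Unset Strict Implicit.
Unset Printing Implicit Defensive.

(** * A structured language compiled to the word RAM *)

(** Two is not invertible modulo [2 ^ w], and this shapes the specification as well as the
    algorithm. Cells are read in an arbitrary commutative ring in which [2 ^ w] vanishes, and a row
    of length [r] is represented by its value at an element whose [r]-th power is -1. Each pass is
    then an identity in that ring and never divides. Only at the end is the ring taken to be
    $(\mathbb Z/2^w)[X]/(X^n+1)$ with the class of $X$ as the element, where a value determines all
    coefficients. The accumulated scale is [2 ^ (bl + L)], and a coefficient counts at most
    [n = 2 ^ bl.+1] pairs; their product stays below [2 ^ w], so a cell is zero exactly when the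
    count is.

    The structured language has only loops whose bound is fixed on entry. Termination is thus
    automatic, the time is an explicit sum over iterations, and results and time can be studied
    apart from registers and jumps. *)

Inductive exp : Type :=
| Var of nat
| Lit of nat
| Bin of binop & exp & exp
| Fetch of exp.

Inductive cmd : Type :=
| Store of exp & exp
| Seq of cmd & cmd
| Let of exp & cmd
| For of exp & cmd
| IfEq of exp & exp & cmd
| IfLt of exp & exp & cmd.

Fixpoint ev (w : nat) (env M : nat -> nat) (e : exp) : nat :=
  match e with
  | Var i => env i
  | Lit k => k %% 2 ^ w
  | Bin o a b => eval_binop w o (ev w env M a) (ev w env M b)
  | Fetch a => M (ev w env M a)
  end.

(* Adding zero reduces the bound of a loop modulo [2 ^ w], so that its counter
   cannot wrap around. *)
Definition bound (e : exp) : exp := Bin OpAdd e (Lit 0).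

(* [d] is the number of variables in scope; [Let] binds variable [d], and
   [For] binds its bound as variable [d] and its counter as variable [d.+1]. *)
Fixpoint sem (w d : nat) (env : nat -> nat) (c : cmd) (M : nat -> nat) :
    nat -> nat :=
  match c with
  | Store a v => upd M (ev w env M a) (ev w env M v)
  | Seq c1 c2 => sem w d env c2 (sem w d env c1 M)
  | Let e c => sem w d.+1 (upd env d (ev w env M e)) c M
  | For e c =>
      let n := ev w env M (bound e) in
      iteri n (fun i => sem w d.+2 (upd (upd env d n) d.+1 i) c) M
  | IfEq a b c =>
      if ev w env M a == ev w env M b then sem w d env c M else M
  | IfLt a b c =>
      if ev w env M a < ev w env M b then sem w d env c M else M
  end.

(** Registers below [d] hold the variables in scope and are only read; the value is left in register
    [d], and higher registers are scratch. *)
Fixpoint compile_exp (d : nat) (e : exp) : seq instr :=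
  match e with
  | Var i => [:: Move d i]
  | Lit k => [:: Const d k]
  | Bin o a b => compile_exp d a ++ compile_exp d.+1 b ++ [:: Op o d d d.+1]
  | Fetch a => compile_exp d a ++ [:: Read d d]
  end.

Fixpoint exp_size (e : exp) : nat :=
  match e with
  | Var _ | Lit _ => 1
  | Bin _ a b => exp_size a + (exp_size b + 1)
  | Fetch a => exp_size a + 1
  end.

Lemma size_compile_exp d e : size (compile_exp d e) = exp_size e.
Proof.
elim: e d => //= [o a IHa b IHb|a IHa] d; first by rewrite !size_cat IHa IHb.
by rewrite size_cat IHa.
Qed.

(** Jump targets are absolute, so the address [p] of the code is a parameter. The registers with the
    bound and the counter of a loop are those that its body sees as variables [d] and [d.+1]. *)
Fixpoint compile (d p : nat) (c : cmd) : seq instr :=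
  match c with
  | Store a v =>
      compile_exp d a ++ compile_exp d.+1 v ++ [:: Write d d.+1]
  | Seq c1 c2 =>
      let C1 := compile d p c1 in C1 ++ compile d (p + size C1) c2
  | Let e c => compile_exp d e ++ compile d.+1 (p + exp_size e) c
  | For e c =>
      let top := p + (exp_size (bound e) + 1) in
      let C := compile d.+2 (top + 2) c in
      compile_exp d (bound e) ++ [:: Const d.+1 0] ++
      [:: JumpLt d.+1 d (top + 2); Jump (top + 2 + size C + 3)] ++ C ++
      [:: Const d.+2 1; Op OpAdd d.+1 d.+1 d.+2; Jump top]
  | IfEq a b c =>
      let q := p + (exp_size a + exp_size b) in
      let C := compile d (q + 2) c in
      compile_exp d a ++ compile_exp d.+1 b ++
      [:: JumpEq d d.+1 (q + 2); Jump (q + 2 + size C)] ++ C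
  | IfLt a b c =>
      let q := p + (exp_size a + exp_size b) in
      let C := compile d (q + 2) c in
      compile_exp d a ++ compile_exp d.+1 b ++
      [:: JumpLt d d.+1 (q + 2); Jump (q + 2 + size C)] ++ C
  end.

(** An exact count. Beyond its body an iteration pays 4: the test, and three instructions to
    increment the counter and jump back. The final 2 are the failed test and the exit jump. A
    conditional pays 1 jump when its body is entered and 2 when it is skipped. *)
Fixpoint cost (w d : nat) (env : nat -> nat) (c : cmd) (M : nat -> nat) : nat :=
  match c with
  | Store a v => exp_size a + (exp_size v + 1)
  | Seq c1 c2 => cost w d env c1 M + cost w d env c2 (sem w d env c1 M)
  | Let e c => exp_size e + cost w d.+1 (upd env d (ev w env M e)) c M
  | For e c =>
      let n := ev w env M (bound e) in
      let env' i := upd (upd env d n) d.+1 i in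
      let body i := sem w d.+2 (env' i) c in
      exp_size (bound e) + 1 +
      (\sum_(i < n) (cost w d.+2 (env' i) c (iteri i body M) + 4) + 2)
  | IfEq a b c =>
      exp_size a + exp_size b +
      (if ev w env M a == ev w env M b then cost w d env c M + 1 else 2)
  | IfLt a b c =>
      exp_size a + exp_size b +
      (if ev w env M a < ev w env M b then cost w d env c M + 1 else 2)
  end.

Fixpoint closed_exp (d : nat) (e : exp) : bool :=
  match e with
  | Var i => i < d
  | Lit _ => true
  | Bin _ a b => closed_exp d a && closed_exp d b
  | Fetch a => closed_exp d a
  end.

Fixpoint closed_cmd (d : nat) (c : cmd) : bool :=
  match c with
  | Store a v => closed_exp d a && closed_exp d v
  | Seq c1 c2 => closed_cmd d c1 && closed_cmd d c2
  | Let e c => closed_exp d e && closed_cmd d.+1 c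
  | For e c => closed_exp d e && closed_cmd d.+2 c
  | IfEq a b c | IfLt a b c =>
      [&& closed_exp d a, closed_exp d b & closed_cmd d c]
  end.

(** * Simulation of the structured language by the word RAM *)

Section CompilerCorrectness.

Variables (w : nat) (P : program).

Inductive steps : nat -> state -> state -> Prop :=
| steps0 s : steps 0 s s
| stepsS t s s1 s2 : step w P s = Some s1 -> steps t s1 s2 -> steps t.+1 s s2.

Lemma steps_trans t1 t2 s1 s2 s3 :
  steps t1 s1 s2 -> steps t2 s2 s3 -> steps (t1 + t2) s1 s3.
Proof. by move=> H; elim: H => // t s s' s'' ss' _ IH /IH; apply: stepsS. Qed.

Lemma step1 s s' : step w P s = Some s' -> steps 1 s s'.
Proof. by move=> ss'; apply: stepsS ss' (steps0 _). Qed.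

Lemma steps_exec t s s' : steps t s s' -> step w P s' = None -> exec w P t s s'.
Proof.
elim=> [{}s /exec_halt //|{}t {}s s1 s2 ss1 _ IH /IH]; exact: exec_step.
Qed.

Definition code_at (p : nat) (C : seq instr) :=
  forall i, i < size C -> nth Halt P (p + i) = nth Halt C i.

Lemma code_at_cat p C1 C2 :
  code_at p (C1 ++ C2) -> code_at p C1 /\ code_at (p + size C1) C2.
Proof.
move=> H; split=> i ltiC.
  by rewrite H ?nth_cat ?ltiC // size_cat ltn_addr.
by rewrite -addnA H ?size_cat ?ltn_add2l // nth_cat ltnNge leq_addr addKn.
Qed.

Lemma code_at_cons p I C :
  code_at p (I :: C) -> nth Halt P p = I /\ code_at p.+1 C.
Proof.
move=> H; split; first by rewrite -[p]addn0 H.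
by move=> i ltiC; rewrite addSnnS H.
Qed.

Definition agree d (env R : nat -> nat) := forall i, i < d -> R i = env i.

Lemma agree_upd d d' env R v : d <= d' -> agree d env R -> agree d env (upd R d' v).
Proof. by move=> dd' H i ltid; rewrite /upd ltn_eqF ?H ?(leq_trans ltid). Qed.

Lemma agreeS d env R v : agree d env R -> R d = v -> agree d.+1 (upd env d v) R.
Proof.
move=> H Rd i; rewrite ltnS leq_eqVlt /upd => /predU1P[->|ltid].
  by rewrite eqxx.
by rewrite ltn_eqF ?H.
Qed.

Lemma agree_updP d env R v : agree d.+1 (upd env d v) R -> agree d env R /\ R d = v.
Proof.
move=> H; split=> [i ltid|]; first by rewrite H ?ltnS ?(ltnW ltid) // /upd ltn_eqF.
by rewrite H // /upd eqxx.
Qed.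

(** The scratch level [d'] may exceed the scope [d], because the second operand of an operation is
    compiled one register higher than the first. *)
Lemma compile_exp_correct d d' env e p R M :
    d <= d' -> closed_exp d e -> agree d env R -> code_at p (compile_exp d' e) ->
  exists R', [/\ steps (exp_size e) (State p R M) (State (p + exp_size e) R' M),
    R' d' = ev w env M e & forall i, i < d' -> R' i = R i].
Proof.
elim: e d' p R => [i|k|o a IHa b IHb|a IHa] d' p R dd' /=.
- move=> ltid HR /code_at_cons[Pp _]; exists (upd R d' (R i)); split.
  + by rewrite addn1; apply: step1; rewrite /= Pp.
  + by rewrite /upd eqxx HR.
  + by move=> j ltj; rewrite /upd ltn_eqF.
- move=> _ HR /code_at_cons[Pp _]; exists (upd R d' (k %% 2 ^ w)); split.
  + by rewrite addn1; apply: step1; rewrite /= Pp.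
  + by rewrite /upd eqxx.
  + by move=> j ltj; rewrite /upd ltn_eqF.
- case/andP=> ca cb HR /code_at_cat[Ha /code_at_cat[Hb /code_at_cons[Hc _]]].
  rewrite !size_compile_exp in Hb Hc.
  have [R1 [S1 V1 F1]] := IHa _ _ _ dd' ca HR Ha.
  have HR1 : agree d env R1 by move=> i ltid; rewrite F1 ?HR // (leq_trans ltid).
  have [R2 [S2 V2 F2]] := IHb _ _ _ (leqW dd') cb HR1 Hb.
  exists (upd R2 d' (eval_binop w o (ev w env M a) (ev w env M b))); split.
  + apply: (steps_trans S1); apply: (steps_trans S2).
    apply: step1; rewrite /= Hc V2 F2 // V1.
    by congr (Some (State _ _ _)); lia.
  + by rewrite /upd eqxx.
  + by move=> i ltid; rewrite /upd ltn_eqF ?F2 ?F1 // ltnW.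
- move=> ca HR /code_at_cat[Ha /code_at_cons[Hc _]].
  rewrite !size_compile_exp in Hc.
  have [R1 [S1 V1 F1]] := IHa _ _ _ dd' ca HR Ha.
  exists (upd R1 d' (M (ev w env M a))); split.
  + apply: (steps_trans S1).
    apply: step1; rewrite /= Hc V1.
    by congr (Some (State _ _ _)); lia.
  + by rewrite /upd eqxx.
  + by move=> i ltid; rewrite /upd ltn_eqF ?F1.
Qed.

Lemma compile_exp2_correct d env a b p R M :
    closed_exp d a -> closed_exp d b -> agree d env R ->
    code_at p (compile_exp d a) -> code_at (p + exp_size a) (compile_exp d.+1 b) ->
  exists R', [/\ steps (exp_size a + exp_size b) (State p R M)
                   (State (p + (exp_size a + exp_size b)) R' M),
    R' d = ev w env M a, R' d.+1 = ev w env M b & agree d env R'].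
Proof.
move=> ca cb HR Ha Hb.
have [R1 [S1 V1 F1]] := compile_exp_correct M (leqnn d) ca HR Ha.
have HR1 : agree d env R1 by move=> i ltid; rewrite F1 ?HR.
have [R2 [S2 V2 F2]] := compile_exp_correct M (leqnSn d) cb HR1 Hb.
exists R2; split=> //; last by move=> i ltid; rewrite F2 ?HR1 // ltnW.
  by rewrite addnA; apply: steps_trans S1 S2.
by rewrite F2.
Qed.

Lemma compile_correct d env c p R M :
    closed_cmd d c -> agree d env R -> code_at p (compile d p c) ->
  exists2 R', steps (cost w d env c M) (State p R M)
                (State (p + size (compile d p c)) R' (sem w d env c M)) &
    agree d env R'.
Proof.
elim: c d env p R M => [a v|c1 IH1 c2 IH2|e c IH|e c IH|a b c IH|a b c IH] d env p R M.
- move=> /=; case/andP=> ca cv HR /code_at_cat[Ha /code_at_cat[Hv /code_at_cons[Hw _]]].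
  rewrite !size_compile_exp in Hv Hw.
  have [R' [S Va Vv HR']] := compile_exp2_correct M ca cv HR Ha Hv.
  exists R' => //; rewrite !size_cat !size_compile_exp /= [in X in steps X]addnA.
  apply: (steps_trans S); apply: step1.
  by rewrite /= addnA Hw Va Vv; congr (Some (State _ _ _)); lia.
- move=> /=; case/andP=> cl1 cl2 HR /code_at_cat[H1 H2].
  have [R1 S1 HR1] := IH1 _ _ _ _ M cl1 HR H1.
  have [R2 S2 HR2] := IH2 _ _ _ _ (sem w d env c1 M) cl2 HR1 H2.
  exists R2 => //; rewrite size_cat addnA; exact: steps_trans S1 S2.
- move=> /=; case/andP=> ce cc HR /code_at_cat[He Hc].
  rewrite size_compile_exp in Hc.
  have [R1 [S1 V1 F1]] := compile_exp_correct M (leqnn d) ce HR He.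
  have HR1 : agree d.+1 (upd env d (ev w env M e)) R1.
    by apply: agreeS => // i ltid; rewrite F1 ?HR.
  have [R2 S2 HR2] := IH _ _ _ _ M cc HR1 Hc.
  exists R2; last by case/agree_updP: HR2.
  by rewrite size_cat size_compile_exp addnA; exact: steps_trans S1 S2.
- case/andP=> ce cc HR.
  have ce' : closed_exp d (bound e) by rewrite /= ce.
  have ltnw : ev w env M (bound e) < 2 ^ w by rewrite ltn_pmod ?expn_gt0.
  cbn [compile sem cost]; move: (bound e) ce' ltnw => {ce}e ce ltnw.
  set top := p + _; set C := compile _ _ _; set n := ev _ _ _ _ in ltnw *.
  move=> /code_at_cat[He]; rewrite size_compile_exp.
  move=> /code_at_cons[H0 /code_at_cons[H1 /code_at_cons[H2]]].
  move=> /code_at_cat[Hc /code_at_cons[H3 /code_at_cons[H4 /code_at_cons[H5 _]]]].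
  have Etop : (p + exp_size e).+1 = top by rewrite /top addn1 -addnS.
  rewrite !Etop -?(addn2 top) in H1 H2 Hc H3 H4 H5.
  have [R1 [S1 V1 F1]] := compile_exp_correct M (leqnn d) ce HR He.
  rewrite -/n in V1.
  pose env' i := upd (upd env d n) d.+1 i.
  pose body i := sem w d.+2 (env' i) c.
  (* Induction on the number [j] of remaining iterations, starting at the head of the loop with the
     counter at [i]. *)
  have loop j i R' : i + j = n -> agree d.+2 (env' i) R' ->
    exists2 R'', steps (\sum_(i <= k < n) (cost w d.+2 (env' k) c (iteri k body M) + 4) + 2)
      (State top R' (iteri i body M)) (State (top + 2 + size C + 3) R'' (iteri n body M)) &
      agree d env R''.
    elim: j i R' => [|j IHj] i R' Eij HR'.
      rewrite addn0 in Eij; subst i; rewrite big_geq // add0n.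
      have [HR1 R'i] := agree_updP HR'; have [HR2 R'd] := agree_updP HR1.
      exists R' => //; apply: (@stepsS _ _ (State top.+1 R' (iteri n body M))).
        by rewrite /= H1 R'i R'd ltnn.
      by apply: step1; rewrite /= H2.
    have ltin : i < n by rewrite -Eij addnS ltnS leq_addr.
    have [HR1 R'i] := agree_updP HR'; have [HR2 R'd] := agree_updP HR1.
    have [R2 S2 HR3] := IH _ _ _ _ (iteri i body M) cc HR' Hc.
    have [HR4 R2i] := agree_updP HR3; have [HR5 R2d] := agree_updP HR4.
    pose R3 := upd (upd R2 d.+2 (1 %% 2 ^ w)) d.+1 i.+1.
    have E3 : (i + 1 %% 2 ^ w) %% 2 ^ w = i.+1.
      by rewrite modnDmr addn1 modn_small // (leq_ltn_trans ltin).
    have HR6 : agree d.+2 (env' i.+1) R3.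
      apply: agreeS; last by rewrite /R3 /upd eqxx.
      apply: agree_upd => //; apply: agree_upd => //.
    have Eij' : i.+1 + j = n by rewrite addSnnS.
    have [R4 S4 HR7] := IHj _ _ Eij' HR6.
    exists R4 => //; rewrite big_ltn //; set rest := \sum_(_ <= _ < _) _ in S4 *.
    rewrite (_ : _ + 4 + rest + 2 =
      1 + (cost w d.+2 (env' i) c (iteri i body M) + (3 + (rest + 2)))); last by lia.
    apply: (@steps_trans 1 _ _ (State (top + 2) R' (iteri i body M))).
      by apply: step1; rewrite /= H1 R'i R'd ltin.
    apply: (steps_trans S2).
    apply: (@steps_trans 3 _ _ (State top R3 (iteri i.+1 body M))) => //.
    apply: (stepsS (s1 := State (top + 2 + size C).+1 (upd R2 d.+2 (1 %% 2 ^ w)) (iteri i.+1 body M))).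
      by rewrite /= -/C H3.
    apply: (stepsS (s1 := State (top + 2 + size C).+2 R3 (iteri i.+1 body M))).
      rewrite /= -/C H4 /R3 /upd !eqxx /=.
      by rewrite (ltn_eqF (ltnSn d.+1)) R2i E3.
    by apply: step1; rewrite /= H5.
  have HR1 : agree d env R1 by move=> i ltid; rewrite F1 ?HR.
  have HR2 : agree d.+2 (env' 0) (upd R1 d.+1 (0 %% 2 ^ w)).
    apply: agreeS; last by rewrite /upd eqxx mod0n.
    by apply: agree_upd => //; apply: agreeS.
  have [R4 S4 HR4] := loop n 0 _ (add0n _) HR2.
  exists R4 => //.
  rewrite big_mkord in S4.
  apply: (@steps_trans _ _ _ (State top (upd R1 d.+1 (0 %% 2 ^ w)) M)).
    apply: (steps_trans S1); apply: step1.
    by rewrite /= H0 Etop.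
  suff <- : top + 2 + size C + 3 = p + size (compile_exp d e ++
      [:: Const d.+1 0, JumpLt d.+1 d (top + 2), Jump (top + 2 + size C + 3) & C ++
      [:: Const d.+2 1; Op OpAdd d.+1 d.+1 d.+2; Jump top]]) by [].
  by rewrite size_cat size_compile_exp /= size_cat /= /top; lia.
- move=> /=; case/and3P=> ca cb cc HR /code_at_cat[Ha /code_at_cat[Hb]].
  rewrite !size_compile_exp => /code_at_cons[H0 /code_at_cons[H1 Hc]].
  rewrite size_compile_exp in Hb.
  have [R1 [S1 V1 V1' HR1]] := compile_exp2_correct M ca cb HR Ha Hb.
  have Eq : (p + exp_size a + exp_size b).+2 = p + (exp_size a + exp_size b) + 2.
    by rewrite addn2 addnA.
  have Ep : p + (exp_size a + exp_size b) = p + exp_size a + exp_size b by rewrite addnA.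
  rewrite !size_cat !size_compile_exp /=.
  set C := compile _ _ _.
  have -> : p + (exp_size a + (exp_size b + (size C).+2)) =
            p + (exp_size a + exp_size b) + 2 + size C by lia.
  case: eqP => Eab.
    rewrite Eq in Hc.
    have [R2 S2 HR2] := IH _ _ _ _ M cc HR1 Hc.
    exists R2 => //; apply: (steps_trans S1); rewrite addn1.
    apply: stepsS S2.
    by rewrite /= Ep H0 V1 V1' Eab eqxx -Ep.
  exists R1 => //; apply: (steps_trans S1).
  apply: (stepsS (s1 := State (p + exp_size a + exp_size b).+1 R1 M)).
    by rewrite /= Ep H0 V1 V1'; case: eqP.
  by apply: step1; rewrite /= H1.
- move=> /=; case/and3P=> ca cb cc HR /code_at_cat[Ha /code_at_cat[Hb]].
  rewrite !size_compile_exp => /code_at_cons[H0 /code_at_cons[H1 Hc]].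
  rewrite size_compile_exp in Hb.
  have [R1 [S1 V1 V1' HR1]] := compile_exp2_correct M ca cb HR Ha Hb.
  have Eq : (p + exp_size a + exp_size b).+2 = p + (exp_size a + exp_size b) + 2.
    by rewrite addn2 addnA.
  have Ep : p + (exp_size a + exp_size b) = p + exp_size a + exp_size b by rewrite addnA.
  rewrite !size_cat !size_compile_exp /=.
  set C := compile _ _ _.
  have -> : p + (exp_size a + (exp_size b + (size C).+2)) =
            p + (exp_size a + exp_size b) + 2 + size C by lia.
  case: ifP => Eab.
    rewrite Eq in Hc.
    have [R2 S2 HR2] := IH _ _ _ _ M cc HR1 Hc.
    exists R2 => //; apply: (steps_trans S1); rewrite addn1.
    apply: stepsS S2.
    by rewrite /= Ep H0 V1 V1' Eab -Ep.
  exists R1 => //; apply: (steps_trans S1).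
  apply: (stepsS (s1 := State (p + exp_size a + exp_size b).+1 R1 M)).
    by rewrite /= Ep H0 V1 V1' Eab.
  by apply: step1; rewrite /= H1.
Qed.

End CompilerCorrectness.

Lemma compile_exec w c N :
  closed_cmd 1 c ->
  exists s, exec w (compile 1 0 c) (cost w 1 (upd (fun=> 0) 0 N) c (fun=> 0)) (init N) s /\
    memory s = sem w 1 (upd (fun=> 0) 0 N) c (fun=> 0).
Proof.
move=> cc.
have [R S _] := @compile_correct w (compile 1 0 c) 1 _ c 0 _ (fun=> 0) cc
  (fun i _ => erefl (upd (fun=> 0) 0 N i)) (fun i _ => erefl).
exists (State (size (compile 1 0 c)) R (sem w 1 (upd (fun=> 0) 0 N) c (fun=> 0))).
(* The counter ends just behind the code, where the default of [nth] is [Halt]. *)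
by split=> //; apply: steps_exec S _; rewrite /= nth_default.
Qed.

(** * Nussbaumer's transform *)

Section Nussbaumer.

Import GRing.Theory.
Local Open Scope ring_scope.

Variable S : comNzRingType.
Implicit Types (y z : S) (a f g u v : nat -> S).

(** The element of $\mathbb Z[y]/(y^r+1)$ stored in row [p], seen through its value at any [y] with
    [y ^+ r = -1]. *)
Definition rowval r y a p : S := \sum_(j < r) a (p * r + j)%N * y ^+ j.

(** These are the coefficients of $y^{-c}u$ when $y^r=-1$. A pass gathers: position [j] reads
    position [j + c], with one sign per wraparound. *)
Definition rotate r c u : nat -> S :=
  fun j => (-1) ^+ ((j + c) %/ r)%N * u ((j + c) %% r)%N.

Lemma rotate_sum r c y u : (0 < r)%N -> y ^+ r = -1 ->
  y ^+ c * (\sum_(j < r) rotate r c u j * y ^+ j) = \sum_(j < r) u j * y ^+ j.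
Proof.
move=> r0 yr; rewrite mulr_sumr.
pose h (j : 'I_r) : 'I_r := Ordinal (ltn_pmod (j + c) r0).
have hI : injective h.
  move=> i j /(congr1 val) /= /eqP; rewrite eqn_modDr !modn_small //.
  by move/eqP/val_inj.
rewrite [RHS](reindex_inj hI) /=; apply: eq_bigr => j _.
rewrite /rotate mulrCA -exprD.
have -> : y ^+ (c + j) = (-1) ^+ ((j + c) %/ r) * y ^+ ((j + c) %% r).
  by rewrite -[in RHS]yr -exprM -exprD [(r * _)%N]mulnC -divn_eq addnC.
set s := _ ^+ _.
have ss : s * s = 1 by rewrite -exprD addnn -mul2n exprM sqrrN !expr1n.
by rewrite mulrACA ss mul1r.
Qed.

Lemma expr2r r y : y ^+ r = -1 -> y ^+ (2 * r) = 1.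
Proof. by move=> yr; rewrite mulnC exprM yr sqrrN expr1n. Qed.

(** Since $y^{2r}=1$, rotating by [(2 * r - 1) * e] is rotating by [-e], expressed without a
    subtraction of indices. *)
Lemma rotate_mulX r e y u : (0 < r)%N -> y ^+ r = -1 ->
  \sum_(j < r) rotate r ((2 * r - 1) * e) u j * y ^+ j =
  y ^+ e * \sum_(j < r) u j * y ^+ j.
Proof.
move=> r0 yr; rewrite -(rotate_sum ((2 * r - 1) * e) u r0 yr) mulrA -exprD.
have -> : (e + (2 * r - 1) * e = 2 * r * e)%N by nia.
by rewrite exprM (expr2r yr) expr1n mul1r.
Qed.

(* Coefficient [i] of the remainder of the polynomial with coefficients [g] of
   size [2 ^ h.+1] modulo [z ^ (2 ^ (h.+1 - d)) - y ^ (b * (2 * r %/ 2 ^ d))].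
   Node [b] at depth [d] has children [b] and [b + 2 ^ d]. *)
Fixpoint node (h r : nat) y g (d b i : nat) : S :=
  if d is d'.+1 then
    node h r y g d' (b %% 2 ^ d')%N i +
    y ^+ (b * (r %/ 2 ^ d')) * node h r y g d' (b %% 2 ^ d')%N (i + 2 ^ (h - d'))%N
  else g i.

(** A root of the modulus of a node is a root of the modulus of its parent, so both remainders take
    the same value there. At depth [d] only [b] modulo [2 ^ d] matters, because $y^{2r}=1$. *)
Lemma node_eval h r y g d b z :
    (d <= h.+1)%N -> (2 ^ h %| r)%N -> y ^+ r = -1 ->
    z ^+ (2 ^ (h.+1 - d)) = y ^+ (b * (2 * r %/ 2 ^ d)) ->
  \sum_(i < 2 ^ (h.+1 - d)) node h r y g d b i * z ^+ i =
  \sum_(i < 2 ^ h.+1) g i * z ^+ i.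
Proof.
move=> + hr yr; elim: d b => [|d IHd] b; first by rewrite subn0.
rewrite ltnS => dh; rewrite subSS expnS divnMl // => zq.
have dr : (2 ^ d %| r)%N by apply: dvdn_trans hr; apply: dvdn_exp2l.
have Eq : (2 ^ (h.+1 - d) = 2 ^ (h - d) + 2 ^ (h - d))%N.
  by rewrite addnn -mul2n -expnS subSn.
rewrite -(IHd (b %% 2 ^ d)%N) ?leqW //; last first.
  rewrite Eq exprD zq -exprD addnn -mul2n.
  rewrite {1}(divn_eq b (2 ^ d)) mulnDl mulnDr exprD.
  have -> : (2 * (b %/ 2 ^ d * 2 ^ d * (r %/ 2 ^ d)) = 2 * r * (b %/ 2 ^ d))%N.
    by rewrite -[in RHS](divnK dr); lia.
  rewrite exprM (expr2r yr) expr1n mul1r; congr (_ ^+ _).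
  by rewrite -muln_divA // mulnCA.
rewrite Eq big_split_ord /= -big_split /=; apply: eq_bigr => i _.
rewrite exprD zq mulrDl; congr (_ + _).
by rewrite addnC; ring.
Qed.

(** At depth [h.+1] the moduli are linear, and the remainders are the Fourier transform of length
    [2 * m], [m = 2 ^ h], at the powers of $y^{r/m}$. Numbering the children [b] and [b + 2 ^ d]
    leaves the values in natural order. *)
Lemma node_leaf h r y g b : (2 ^ h %| r)%N -> y ^+ r = -1 ->
  node h r y g h.+1 b 0 = \sum_(i < 2 ^ h.+1) g i * y ^+ (b * (r %/ 2 ^ h)) ^+ i.
Proof.
move=> hr yr; rewrite -(@node_eval h r y g h.+1 b) //.
  by rewrite subnn big_ord1 expr0 mulr1.
by rewrite subnn expr1 expnS divnMl.
Qed.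

(** The inverse butterfly, with its factor 2 left in place. The twiddle factors of the two children
    differ by $y^r=-1$, so sum and difference isolate the halves of the parent. *)
Lemma node_pair h r y g d b i : (b < 2 ^ d)%N -> (2 ^ d %| r)%N -> y ^+ r = -1 ->
  (node h r y g d.+1 b i + node h r y g d.+1 (b + 2 ^ d)%N i
     = 2 * node h r y g d b i) *
  (node h r y g d.+1 b i - node h r y g d.+1 (b + 2 ^ d)%N i
     = 2 * (y ^+ (b * (r %/ 2 ^ d)) * node h r y g d b (i + 2 ^ (h - d))%N)).
Proof.
move=> bd dr yr /=; rewrite modnDr modn_small // mulnDl exprD.
have -> : (2 ^ d * (r %/ 2 ^ d) = r)%N by rewrite mulnC divnK.
by rewrite yr; split; ring.
Qed.

(** Padding to length [2 * m] leaves room for the whole product of two polynomials with [m]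
    coefficients. *)
Definition padded m f : nat -> S := fun i => if (i < m)%N then f i else 0.

Definition product m f g : nat -> S :=
  fun i => \sum_(p < m) \sum_(q < m | (p + q == i)%N) f p * g q.

Lemma padded_eval m f z :
  \sum_(i < m + m) padded m f i * z ^+ i = \sum_(i < m) f i * z ^+ i.
Proof.
rewrite big_split_ord /= [X in _ + X]big1 => [|i _]; last first.
  by rewrite /padded ltnNge leq_addr mul0r.
by rewrite addr0; apply: eq_bigr => i _; rewrite /padded ltn_ord.
Qed.

Lemma product_eval m f g z :
  \sum_(i < m + m) product m f g i * z ^+ i =
  (\sum_(i < m) f i * z ^+ i) * (\sum_(i < m) g i * z ^+ i).
Proof.
under eq_bigr => i _ do rewrite mulr_suml.
rewrite exchange_big mulr_suml; apply: eq_bigr => p _.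
under eq_bigr => i _ do rewrite mulr_suml big_mkcond.
rewrite exchange_big mulr_sumr; apply: eq_bigr => q _ /=.
have lt_pq : (p + q < m + m)%N by rewrite -addnS leq_add // ltnW.
rewrite (bigD1 (Ordinal lt_pq)) //= eqxx big1 => [|i].
  by rewrite addr0 exprD; ring.
by rewrite -val_eqE /= eq_sym => /negbTE ->.
Qed.

End Nussbaumer.

(** * Index arithmetic and array passes *)

Declare Scope exp_scope.
Delimit Scope exp_scope with exp.
Bind Scope exp_scope with exp.
Notation "a + b" := (Bin OpAdd a b) : exp_scope.
Notation "a - b" := (Bin OpSub a b) : exp_scope.
Notation "a * b" := (Bin OpMul a b) : exp_scope.
Notation "a %/ b" := (Bin OpDiv a b) : exp_scope.
Notation "a %% b" := (Bin OpMod a b) : exp_scope.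
Definition pow2 (a : exp) : exp := Bin OpShl (Lit 1) a.

Lemma ltn_mixed x y X Y : x < X -> y < Y -> x * Y + y < X * Y.
Proof.
move=> xX yY; apply: (@leq_trans (x.+1 * Y)); first by rewrite mulSn addnC ltn_add2r.
by rewrite leq_mul2r xX orbT.
Qed.

Lemma eq_iteri_lt T n (f g : nat -> T -> T) x :
  (forall i y, i < n -> f i y = g i y) -> iteri n f x = iteri n g x.
Proof.
elim: n => //= n IH fg; rewrite IH ?fg // => i y ltin.
by apply: fg; apply: ltnW.
Qed.

Lemma iteri_ind T (Q : nat -> T -> Prop) n (f : nat -> T -> T) x :
  Q 0 x -> (forall i y, i < n -> Q i y -> Q i.+1 (f i y)) -> Q n (iteri n f x).
Proof.
move=> Q0 QS; elim: {-2}n (leqnn n) => //= m IH ltmn.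
by apply: QS => //; apply: IH; apply: ltnW.
Qed.

(** The stored values depend only on cells outside the block being written, so the sequential loop
    acts as a simultaneous assignment. *)
Lemma iteri_upd n B (val : nat -> (nat -> nat) -> nat) M a :
    (forall i M1, i < n -> (forall c, ~~ (B <= c < B + n) -> M1 c = M c) ->
      val i M1 = val i M) ->
  iteri n (fun i M1 => upd M1 (B + i) (val i M1)) M a =
  if B <= a < B + n then val (a - B) M else M a.
Proof.
move=> Hval.
suff /(_ n (leqnn n)) -> : forall m, m <= n -> forall a,
    iteri m (fun i M1 => upd M1 (B + i) (val i M1)) M a =
    if B <= a < B + m then val (a - B) M else M a by [].
elim=> [|m IH] lemn {}a; first by rewrite addn0 /=; case: ifP => //; lia.
rewrite /= /upd; case: eqP => [->|neq].
  rewrite addKn leq_addr ltn_add2l ltnSn /=.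
  apply: Hval => // c cP; rewrite IH; last exact: ltnW.
  by case: ifP => //; lia.
rewrite IH; last exact: ltnW.
by congr (if _ then _ else _); lia.
Qed.

Lemma ev_Fetch w env M a : ev w env M (Fetch a) = M (ev w env M a).
Proof. by []. Qed.

Lemma ev_Add w env M a b :
  ev w env M (a + b)%exp = (ev w env M a + ev w env M b) %% 2 ^ w.
Proof. by []. Qed.

Lemma ev_Mul w env M a b :
  ev w env M (a * b)%exp = (ev w env M a * ev w env M b) %% 2 ^ w.
Proof. by []. Qed.

Lemma sem_Store w d env a x M :
  sem w d env (Store a x) M = upd M (ev w env M a) (ev w env M x).
Proof. by []. Qed.

Lemma sem_Seq w d env c1 c2 M :
  sem w d env (Seq c1 c2) M = sem w d env c2 (sem w d env c1 M).
Proof. by []. Qed.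

Lemma sem_Let w d env e c M v : ev w env M e = v ->
  sem w d env (Let e c) M = sem w d.+1 (upd env d v) c M.
Proof. by move=> <-. Qed.

(** Result and time are paired so that unfolding a chain of [Let] once serves both correctness and
    cost. *)
Definition run w d env c M := (sem w d env c M, cost w d env c M).

Definition add_time k (r : (nat -> nat) * nat) := (r.1, k + r.2).

Lemma add_timeD k l r : add_time k (add_time l r) = add_time (k + l) r.
Proof. by rewrite /add_time /= addnA. Qed.

Lemma run_Let w d env e c M v : ev w env M e = v ->
  run w d env (Let e c) M = add_time (exp_size e) (run w d.+1 (upd env d v) c M).
Proof. by move=> <-. Qed.

Lemma ev_bound w env M e n : ev w env M e = n -> n < 2 ^ w ->
  ev w env M (bound e) = n.
Proof. by move=> /= -> ltn; rewrite mod0n addn0 modn_small. Qed.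

Lemma sem_For w d env e c M n : ev w env M e = n -> n < 2 ^ w ->
  sem w d env (For e c) M =
  iteri n (fun i => sem w d.+2 (upd (upd env d n) d.+1 i) c) M.
Proof. by move=> en ltn; cbn [sem]; rewrite (ev_bound en ltn). Qed.

(* Index expressions are evaluated without overflow.  The variable [x],
   holding the base address of a buffer, is exempt from the size bound and may
   not occur in them. *)
Fixpoint evN (env : nat -> nat) (e : exp) : nat :=
  match e with
  | Var i => env i
  | Lit k => k
  | Bin OpAdd a b => evN env a + evN env b
  | Bin OpMul a b => evN env a * evN env b
  | Bin OpDiv a b => evN env a %/ evN env b
  | Bin OpMod a b => evN env a %% evN env b
  | _ => 0
  end.

Fixpoint is_index (x : nat) (e : exp) : bool :=
  match e with
  | Var i => i != x
  | Lit k => true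
  | Bin o a b =>
      match o with OpAdd | OpMul | OpDiv | OpMod => true | _ => false end &&
      (is_index x a && is_index x b)
  | Fetch _ => false
  end.

(** Bounds the bits of an index, and of its intermediate values, when variables have [v] bits:
    adding the two lengths plus one covers sums as well as products, and $k<2^k$ covers literals.
    The estimate is crude, whence the generous hypothesis [100 * v + 100 <= e] below. *)
Fixpoint index_bits (v : nat) (e : exp) : nat :=
  match e with
  | Var i => v
  | Lit k => k
  | Bin _ a b => (index_bits v a + index_bits v b).+1
  | _ => 0
  end.

Lemma ltn_2pow k w : k < w -> k < 2 ^ w.
Proof. by move=> kw; apply: ltn_trans kw (ltn_expl w (isT : 1 < 2)). Qed.

Lemma ltn_exp2 m n k : k < 2 ^ m -> m <= n -> k < 2 ^ n.
Proof. by move=> km mn; apply: leq_trans km _; rewrite leq_exp2l. Qed.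

Lemma ev_index w v x env M e :
    is_index x e -> (forall i, i != x -> env i < 2 ^ v) -> index_bits v e <= w ->
  ev w env M e = evN env e /\ evN env e < 2 ^ index_bits v e.
Proof.
move=> + Henv; elim: e => //= [i /Henv //|k _ kw|].
  have ltk : k < 2 ^ k by apply: ltn_expl.
  by rewrite modn_small //; apply: ltn_exp2 kw.
move=> o a IHa b IHb /andP[oP /andP[/IHa{}IHa /IHb{}IHb]] lew.
have [|-> lta] := IHa; first by lia.
have [|-> ltb] := IHb; first by lia.
have pow_gt0 k : 0 < 2 ^ k by rewrite expn_gt0.
have exp_ltn n k : n < 2 ^ k -> k <= w -> n %% 2 ^ w = n.
  by move=> nk kw; rewrite modn_small //; apply: ltn_exp2 nk kw.
rewrite expnS expnD in lew *.
set A := 2 ^ _ in lta *; set B := 2 ^ _ in ltb *.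
have A0 : 0 < A := pow_gt0 _; have B0 : 0 < B := pow_gt0 _.
have EAB : 2 * (A * B) = 2 ^ (index_bits v a + index_bits v b).+1 by rewrite expnS expnD.
case: o oP => //= _.
- have H : evN env a + evN env b < 2 * (A * B) by nia.
  by rewrite (exp_ltn _ _ _ lew) // -EAB.
- have H : evN env a * evN env b < 2 * (A * B) by nia.
  by rewrite (exp_ltn _ _ _ lew) // -EAB.
- by split=> //; apply: leq_ltn_trans (leq_div _ _) _; nia.
- by split=> //; apply: leq_ltn_trans (leq_mod _ _) _; nia.
Qed.

(* Variable 3 holds the address [D] of the array; a pass builds the new array
   at address [2 * D] and then copies it back. *)
Definition base_var := 3.
Notation buf e := (Fetch (Bin OpAdd (Var base_var) e)).

Definition pass (d len : nat) (g : exp) : cmd :=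
  Seq (For (Var len) (Store (Var base_var + Var base_var + Var d.+1)%exp g))
      (For (Var len)
         (Store (Var base_var + Var d.+1)%exp (Fetch (Var base_var + Var base_var + Var d.+1)%exp))).

Section Machine.

(* [2 ^ v] bounds the variables, [2 ^ e] the indices. *)
Variables (w v e : nat).
Hypothesis (ve : v <= e) (ew : e.+2 <= w).

Notation D := (2 ^ e).

Definition small_env (env : nat -> nat) :=
  env base_var = D /\ forall i, i != base_var -> env i < 2 ^ v.

Lemma small_env_upd env i x : i != base_var -> x < 2 ^ v -> small_env env ->
  small_env (upd env i x).
Proof.
move=> iD xv [HD Hi]; split; first by rewrite /upd eq_sym (negPf iD).
by move=> j jD; rewrite /upd; case: eqP => // _; apply: Hi.
Qed.

Let D4w : 4 * D <= 2 ^ w.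
Proof. by rewrite -[4]/(2 ^ 2) -expnD leq_exp2l. Qed.

Lemma ev_buf env M i : small_env env -> is_index base_var i -> index_bits v i <= e ->
  ev w env M (buf i) = M (D + evN env i) /\ evN env i < D.
Proof.
move=> [HD Hi] ii li; have [|Ei lti] := ev_index M ii Hi (w := w); first by lia.
have ltD := ltn_exp2 lti li.
by split=> //=; rewrite HD Ei modn_small //; move: D4w; lia.
Qed.

(** Confines the reads of [g] to addresses from [D] up to [2 * D - 1], disjoint from the new array
    being built at [2 * D]. *)
Fixpoint reads_buf (g : exp) : Prop :=
  match g with
  | Fetch (Bin OpAdd (Var x) i) =>
      [/\ x == base_var, is_index base_var i & index_bits v i <= e]
  | Fetch _ => False
  | Bin _ a b => reads_buf a /\ reads_buf b
  | _ => True
  end.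

Lemma ev_reads_buf env g M M' : small_env env -> reads_buf g ->
    (forall a, a < D -> M (D + a) = M' (D + a)) ->
  ev w env M g = ev w env M' g.
Proof.
move=> He + HM; elim: g => //= [o a IHa b IHb [/IHa -> /IHb ->] //|].
case=> // -[] // -[] // x i _ [/eqP -> ii li].
rewrite -!/(ev w env _ (buf i)).
by have [-> lti] := ev_buf M He ii li; have [-> _] := ev_buf M' He ii li; apply: HM.
Qed.

(** Every new entry is computed from the old array, since [g] never reads what the first loop
    writes. Cells below [D], which will hold the complexities, stay untouched. *)
Lemma pass_sem d len g env M :
    base_var < d -> small_env env -> len < d ->  len != base_var -> reads_buf g ->
  let M' := sem w d env (pass d len g) M in
  (forall t, t < env len ->
     M' (D + t) = ev w (upd (upd env d (env len)) d.+1 t) M g) /\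
  (forall a, a < D -> M' a = M a).
Proof.
move=> dD He ltld lenD rg; have [HD Hi] := He.
pose G M t := ev w (upd (upd env d (env len)) d.+1 t) M g.
have HGM M0 M' t : t < env len -> (forall a, a < D -> M0 (D + a) = M' (D + a)) ->
    G M0 t = G M' t.
  move=> ltt HM; apply: ev_reads_buf => //.
  have lenv : env len < 2 ^ v by apply: Hi.
  by apply: small_env_upd; last apply: small_env_upd => //; rewrite ?neq_ltn ?ltnS ?(ltnW dD) ?dD ?orbT // (ltn_trans ltt).
have ltn : env len < D by apply: ltn_exp2 ve; apply: Hi.
have ltnw : env len < 2 ^ w by apply: leq_trans ltn _; rewrite leq_exp2l; lia.
have E1 M1 t : t < env len ->
    ev w (upd (upd env d (env len)) d.+1 t) M1 (Var base_var + Var base_var + Var d.+1)%exp = D + D + t.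
  move=> ltt; rewrite /= /upd eqxx !ltn_eqF //; last by rewrite ltnW.
  by rewrite HD !modn_small //; move: D4w; lia.
have E2 M1 t : t < env len ->
    ev w (upd (upd env d (env len)) d.+1 t) M1 (Var base_var + Var d.+1)%exp = D + t.
  move=> ltt; rewrite /= /upd eqxx !ltn_eqF //; last by rewrite ltnW.
  by rewrite HD !modn_small //; move: D4w; lia.
have HFor c M0 : sem w d env (For (Var len) c) M0 =
    iteri (env len) (fun i => sem w d.+2 (upd (upd env d (env len)) d.+1 i) c) M0.
  exact: sem_For.
rewrite /pass sem_Seq !HFor; set M1 := iteri _ _ M.
have HM1 a : M1 a = if D + D <= a < D + D + env len then G M (a - (D + D)) else M a.
  rewrite /M1 (eq_iteri_lt (g := fun i M1 => upd M1 (D + D + i) (G M1 i))); last first.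
    by move=> i y lti; rewrite sem_Store E1.
  rewrite iteri_upd // => i M2 lti HM2; apply: HGM => // c ltc.
  by apply: HM2; lia.
set M2 := iteri _ _ M1.
have HM2 a : M2 a = if D <= a < D + env len then M1 (D + D + (a - D)) else M1 a.
  rewrite /M2 (eq_iteri_lt (g := fun i M1 => upd M1 (D + i) (M1 (D + D + i)))); last first.
    by move=> i y lti; rewrite sem_Store E2 //; rewrite ev_Fetch E1.
  rewrite iteri_upd // => i M3 lti HM3; apply: HM3.
  by lia.
split=> [t ltt|a lta].
  rewrite HM2 ifT ?addKn; last by lia.
  by rewrite HM1 ifT ?addKn //; lia.
by rewrite HM2 ifF ?HM1 ?ifF //; lia.
Qed.

(** * Words as elements of a ring in which [2 ^ w] vanishes *)

Section Values.

Import GRing.Theory.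
Local Open Scope ring_scope.

Variable S : comNzRingType.
Hypothesis Sw : (2 ^ w)%:R = 0 :> S.

Lemma natr_mod x : (x %% 2 ^ w)%:R = x%:R :> S.
Proof. by rewrite [in RHS](divn_eq x (2 ^ w)) natrD natrM Sw mulr0 add0r. Qed.

Lemma natr_sub x z : (z <= 2 ^ w)%N -> ((x + 2 ^ w - z) %% 2 ^ w)%:R = x%:R - z%:R :> S.
Proof.
by move=> zw; rewrite natr_mod natrB ?natrD ?Sw ?addr0 // (leq_trans zw) ?leq_addl.
Qed.

Definition sign_exp q := (Lit 1 - Lit 2 * (q %% Lit 2))%exp.

Lemma ev_sign env M q : small_env env -> is_index base_var q -> (index_bits v q <= e)%N ->
  (ev w env M (sign_exp q))%:R = (-1) ^+ evN env q :> S.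
Proof.
move=> [HD Hi] iq lq; have [|Eq ltq] := ev_index M iq Hi (w := w); first by lia.
have w2 : (2 < 2 ^ w)%N by apply: (@leq_trans (2 ^ 2)%N) => //; rewrite leq_exp2l; lia.
rewrite /= Eq natr_sub; last by apply/ltnW; rewrite ltn_pmod ?expn_gt0.
rewrite [(2 %% 2 ^ w)%N]modn_small // !natr_mod natrM modn2 -signr_odd; case: odd => /=; ring.
Qed.

Definition cells (M : nat -> nat) : nat -> S := fun t => (M (D + t)%N)%:R.

Definition rot_read (r j c p : exp) : exp :=
  (sign_exp ((j + c) %/ r) * buf (p * r + (j + c) %% r))%exp.

Lemma ev_rot_read env M r j c p :
  small_env env -> is_index base_var (p * r + (j + c) %% r + (j + c) %/ r)%exp ->
  (index_bits v (p * r + (j + c) %% r + (j + c) %/ r)%exp <= e)%N ->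
  (ev w env M (rot_read r j c p))%:R =
  rotate (evN env r) (evN env c) (fun i => cells M (evN env p * evN env r + i)) (evN env j).
Proof.
move=> He iq lq; rewrite /rot_read ev_Mul natr_mod natrM.
have /andP[i1 i2] : is_index base_var (p * r + (j + c) %% r)%exp && is_index base_var ((j + c) %/ r)%exp.
  exact: iq.
rewrite (ev_sign M He i2); last by move: lq => /=; lia.
congr (_ * _)%R.
have [|E _] := ev_buf M He i1; first by move: lq => /=; lia.
by rewrite E.
Qed.

End Values.
End Machine.

(** * The passes of the transform *)

(* Variables: 14 the number [m] of coefficients, 15 the row length [r],
   16 [2 * r - 1], 17 the length of the array, 20 [2 ^ s], 21 [m %/ 2 ^ s],
   22 [r %/ 2 ^ s]. *)
Definition expand_exp : exp :=
  let t := Var 19 in let m := Var 14 in let r := Var 15 in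
  let row := (t %/ r)%exp in
  buf (row %/ (Lit 2 * m) * (m * r) + (row %% m + m * (t %% r))).

(** A row number is [(row * (2 * s2) + b) * q + i], with [i] the coefficient inside node [b]. The
    parent is node [b %% s2], its two halves lie [q] rows apart, and multiplying the upper half by
    $y^{b\cdot es}$ is a rotation. *)
Definition fwd_exp : exp :=
  let t := Var 24 in let m := Var 14 in let r := Var 15 in
  let s2 := Var 20 in let q := Var 21 in let es := Var 22 in
  let row := (t %/ r)%exp in
  let b := ((row %/ q) %% (Lit 2 * s2))%exp in
  let p := (row %/ (Lit 2 * m) * (Lit 2 * m) + (b %% s2 * (Lit 2 * q) + row %% q))%exp in
  (buf (p * r + t %% r) + rot_read r (t %% r) (Var 16 * (b * es)) (p + q))%exp.

(** Rows have length 2 and are multiplied like Gaussian integers, as $y^2=-1$; the second operand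
    starts at index [len]. *)
Definition base_exp : exp :=
  let t := Var 11 in let len := Var 9 in
  let row := (t %/ Lit 2 * Lit 2)%exp in
  let j := (t %% Lit 2)%exp in
  (buf row * buf (len + (row + j)) +
   sign_exp (j + Lit 1) * (buf (row + Lit 1) * buf (len + (row + (j + Lit 1) %% Lit 2))))%exp.

(** One formula for both halves of a parent: the sum of the children for [hi = 0], and their
    difference divided by $y^{b\cdot es}$ for [hi = 1]. The children [b] and [b + s2] are [m] rows
    apart. *)
Definition inv_exp : exp :=
  let t := Var 24 in let m := Var 14 in let r := Var 15 in
  let s2 := Var 20 in let q := Var 21 in let es := Var 22 in
  let row := (t %/ r)%exp in
  let hi := ((row %/ q) %% Lit 2)%exp in
  let b := ((row %/ (Lit 2 * q)) %% s2)%exp in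
  let p := (row %/ (Lit 2 * m) * (Lit 2 * m) + (b * q + row %% q))%exp in
  let c := (hi * (b * es))%exp in
  (rot_read r (t %% r) c p + sign_exp hi * rot_read r (t %% r) c (p + m))%exp.

(** Folds [2 * m] coefficients to [m] by $x^{m+i}=y\,x^i$, the rotation by [2 * r - 1] being
    multiplication by $y$, and returns to the order of the powers of $x$. *)
Definition reduce_exp : exp :=
  let t := Var 20 in let m := Var 14 in let r := Var 15 in
  let j := ((t %/ m) %% r)%exp in
  let p := (t %/ (m * r) * (Lit 2 * m) + t %% m)%exp in
  (buf (p * r + j) + rot_read r j (Var 16) (p + m))%exp.

Section Passes.

Import GRing.Theory.
Local Open Scope ring_scope.

Variables (w v e : nat).
Hypothesis (ve : (100 * v + 100 <= e)%N) (ew : (e.+2 <= w)%N).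
Variable S : comNzRingType.
Hypothesis Sw : (2 ^ w)%:R = 0 :> S.

Notation D := (2 ^ e)%N.
Notation small := (small_env v e).
Notation cells := (@cells e S).

Let ve' : (v <= e)%N. Proof. by lia. Qed.

Let ev_cell env M i : small env -> is_index base_var i -> (index_bits v i <= e)%N ->
  ev w env M (buf i) = M (D + evN env i)%N.
Proof. by move=> He ii li; have [] := ev_buf ve' ew M He ii li. Qed.

Lemma small_loop env d n t : (base_var < d)%N -> small env -> (n < 2 ^ v)%N -> (t < n)%N ->
  small (upd (upd env d n) d.+1 t).
Proof.
move=> dD He nv tn; apply: small_env_upd; last apply: small_env_upd => //.
- by rewrite neq_ltn ltnS (ltnW dD) orbT.
- exact: ltn_trans nv.
- by rewrite neq_ltn dD orbT.
Qed.

(** Both halves [b] receive the same copy: with a zero upper half, the first butterfly adds zero to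
    either child, so this transposing copy already performs it. *)
Lemma expand_pass env M m r len :
    small env -> env 14 = m -> env 15 = r -> env 17 = len -> (0 < r)%N ->
  let M' := sem w 18 env (pass 18 17 expand_exp) M in
  (forall row b i j, (b < 2)%N -> (i < m)%N -> (j < r)%N ->
     (((row * 2 + b) * m + i) * r + j < len)%N ->
     cells M' (((row * 2 + b) * m + i) * r + j) = cells M (row * (m * r) + (i + m * j))) /\
  (forall a, (a < D)%N -> M' a = M a).
Proof.
move=> He Em Er Elen r0 M'.
have [||||H1 H2] := pass_sem (w := w) ve' ew (d := 18) (len := 17) (g := expand_exp) M _ He => //.
  by split=> //=; lia.
split=> // row b i j b2 im jr tlen; rewrite /cells.
rewrite /M' H1 ?Elen //; set t := (_ * r + j)%N.
have He' : small (upd (upd env 18 len) 19 t).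
  by apply: small_loop => //; rewrite -Elen; apply: (proj2 He).
rewrite /expand_exp (ev_cell M He') //; last by clear -ve; move=> /=; lia.
rewrite /= /upd /= Em Er.
have Et : (t %/ r = (row * 2 + b) * m + i)%N by rewrite /t divnMDl // divn_small // addn0.
have -> : (t %% r = j)%N by rewrite /t modnMDl modn_small.
rewrite Et.
have -> : (((row * 2 + b) * m + i) %% m = i)%N by rewrite modnMDl modn_small.
have -> : (((row * 2 + b) * m + i) %/ (2 * m) = row)%N.
  rewrite (_ : (_ * m + i = row * (2 * m) + (b * m + i))%N); last by lia.
  by rewrite divnMDl ?divn_small ?addn0 //; nia.
by [].
Qed.

Lemma fwd_pass env M m r s2 q es len y rows :
    small env -> env 14 = m -> env 15 = r -> env 16 = (2 * r - 1)%N -> env 17 = len ->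
    env 20 = s2 -> env 21 = q -> env 22 = es ->
    (0 < r)%N -> (s2 * q = m)%N -> len = (rows * r)%N -> y ^+ r = -1 ->
  let M' := sem w 23 env (pass 23 17 fwd_exp) M in
  (forall row b i, (b < 2 * s2)%N -> (i < q)%N -> ((row * (2 * s2) + b) * q + i < rows)%N ->
     rowval r y (cells M') ((row * (2 * s2) + b) * q + i) =
     rowval r y (cells M) (row * (2 * m) + (b %% s2 * (2 * q) + i)) +
     y ^+ (b * es) *
     rowval r y (cells M) (row * (2 * m) + (b %% s2 * (2 * q) + i) + q)) /\
  (forall a, (a < D)%N -> M' a = M a).
Proof.
move=> He Em Er Eu Elen Es Eq Ees r0 Esq Elr yr M'.
have [||||H1 H2] := pass_sem (w := w) ve' ew (d := 23) (len := 17) (g := fwd_exp) M _ He => //.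
  by clear -ve; repeat split=> //=; lia.
split=> // row b i b2 iq Prows; rewrite /rowval.
set P := ((_ + b) * q + i)%N; set p := (row * _ + _)%N.
rewrite -(rotate_mulX (b * es) (fun j => cells M ((p + q) * r + j)) r0 yr) -big_split /=; apply: eq_bigr => -[j jr] _ /=.
rewrite -mulrDl; congr (_ * _).
have ltlen : (P * r + j < len)%N by rewrite Elr ltn_mixed.
rewrite {1}/cells /M' H1 ?Elen //; set t := (_ * r + j)%N.
have He' : small (upd (upd env 23 len) 24 t).
  by apply: small_loop => //; rewrite -Elen; apply: (proj2 He).
rewrite /fwd_exp ev_Add (natr_mod Sw) natrD.
rewrite (ev_rot_read ve' ew Sw M He') //; last by clear -ve; move=> /=; lia.
rewrite (ev_cell M He') //; last by clear -ve; move=> /=; lia.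
rewrite /= /upd /= Em Er Eu Es Eq Ees.
have Et : (t %/ r = P)%N by rewrite /t divnMDl // divn_small // addn0.
have -> : (t %% r = j)%N by rewrite /t modnMDl modn_small.
rewrite Et.
have -> : (P %% q = i)%N by rewrite /P modnMDl modn_small.
have -> : (P %/ (2 * m) = row)%N.
  rewrite (_ : P = row * (2 * m) + (b * q + i))%N; last by rewrite /P -Esq; ring.
  have bm : (b * q + i < 2 * m)%N by rewrite -Esq mulnA ltn_mixed.
  by rewrite divnMDl ?divn_small ?addn0 //; apply: leq_ltn_trans bm.
have -> : (P %/ q = row * (2 * s2) + b)%N.
  by rewrite /P divnMDl ?divn_small ?addn0 //; lia.
by rewrite modnMDl (modn_small b2).
Qed.

Lemma base_pass env M len y rows :
    small env -> env 9 = len -> len = (rows * 2)%N -> y ^+ 2 = -1 ->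
  let M' := sem w 10 env (pass 10 9 base_exp) M in
  (forall p, (p < rows)%N ->
     rowval 2 y (cells M') p = rowval 2 y (cells M) p * rowval 2 y (cells M) (rows + p)) /\
  (forall a, (a < D)%N -> M' a = M a).
Proof.
move=> He Elen Elr yr M'.
have [||||H1 H2] := pass_sem (w := w) ve' ew (d := 10) (len := 9) (g := base_exp) M _ He => //.
  by clear -ve; repeat split=> //=; lia.
split=> // p prows.
have key j : (j < 2)%N -> cells M' (p * 2 + j) =
    cells M (p * 2) * cells M (len + (p * 2 + j)) +
    (-1) ^+ (j + 1) * (cells M (p * 2 + 1) * cells M (len + (p * 2 + (j + 1) %% 2))).
  move=> j2; have ltlen : (p * 2 + j < len)%N by rewrite Elr; lia.
  rewrite {1}/cells /M' H1 ?Elen //; set t := (_ * 2 + j)%N.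
  have He' : small (upd (upd env 10 len) 11 t).
    by apply: small_loop => //; rewrite -Elen; apply: (proj2 He).
  rewrite /base_exp ev_Add (natr_mod Sw) natrD ev_Mul (natr_mod Sw) natrM.
  rewrite ev_Mul (natr_mod Sw) natrM (ev_sign ve' ew Sw M He') //; last by clear -ve; move=> /=; lia.
  rewrite ev_Mul (natr_mod Sw) natrM.
  rewrite !(ev_cell M He') //; try by clear -ve; move=> /=; lia.
  rewrite /= /upd /= Elen.
  have -> : (t %/ 2 = p)%N by rewrite /t; lia.
  by have -> : (t %% 2 = j)%N by rewrite /t; lia.
have k0 := key 0%N isT; have k1 := key 1%N isT.
rewrite /rowval !big_ord_recr !big_ord0 /= !add0r {}k0 {}k1.
have -> : ((rows + p) * 2 = len + p * 2)%N by lia.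
rewrite -[(0 + 1)%N]/1%N -[(1 + 1)%N]/2%N modnn modn_small // !addn0 -addnA.
rewrite expr0 !expr1 !mulr1.
set a0 := cells M (p * 2); set a1 := cells M (p * 2 + 1).
set b0 := cells M (len + p * 2); set b1 := cells M (len + (p * 2 + 1)).
have -> : (a0 + a1 * y) * (b0 + b1 * y) = a0 * b0 + (a0 * b1 + a1 * b0) * y + a1 * b1 * y ^+ 2 by ring.
by rewrite yr sqrrN expr1n; ring.
Qed.

(** The rotation divides by a power of [y]; the power is moved to the other side to keep the
    equation free of inverses. *)
Lemma inv_pass env M m r s2 q es len y rows :
    small env -> env 14 = m -> env 15 = r -> env 17 = len ->
    env 20 = s2 -> env 21 = q -> env 22 = es ->
    (0 < r)%N -> (s2 * q = m)%N -> len = (rows * r)%N -> y ^+ r = -1 ->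
  let M' := sem w 23 env (pass 23 17 inv_exp) M in
  (forall row b hi i, (b < s2)%N -> (hi < 2)%N -> (i < q)%N ->
     ((row * s2 + b) * (2 * q) + (hi * q + i) < rows)%N ->
     y ^+ (hi * (b * es)) *
     rowval r y (cells M') ((row * s2 + b) * (2 * q) + (hi * q + i)) =
     rowval r y (cells M) (row * (2 * m) + (b * q + i)) +
     (-1) ^+ hi * rowval r y (cells M) (row * (2 * m) + (b * q + i) + m)) /\
  (forall a, (a < D)%N -> M' a = M a).
Proof.
move=> He Em Er Elen Es Eq Ees r0 Esq Elr yr M'.
have [||||H1 H2] := pass_sem (w := w) ve' ew (d := 23) (len := 17) (g := inv_exp) M _ He => //.
  by clear -ve; repeat split=> //=; lia.
split=> // row b hi i bs h2 iq Prows; rewrite /rowval.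
set P := (_ * (2 * q) + _)%N; set p := (row * (2 * m) + _)%N.
rewrite -(rotate_sum (hi * (b * es)) (fun j => cells M (p * r + j)) r0 yr).
rewrite -(rotate_sum (hi * (b * es)) (fun j => cells M ((p + m) * r + j)) r0 yr).
rewrite [(-1) ^+ hi * _]mulrCA -mulrDr; congr (_ * _).
rewrite mulr_sumr -big_split /=; apply: eq_bigr => -[j jr] _ /=.
rewrite mulrA -mulrDl; congr (_ * _).
have ltlen : (P * r + j < len)%N by rewrite Elr ltn_mixed.
rewrite {1}/cells /M' H1 ?Elen //; set t := (_ * r + j)%N.
have He' : small (upd (upd env 23 len) 24 t).
  by apply: small_loop => //; rewrite -Elen; apply: (proj2 He).
rewrite /inv_exp ev_Add (natr_mod Sw) natrD ev_Mul (natr_mod Sw) natrM.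
rewrite (ev_sign ve' ew Sw M He') //; last by clear -ve; move=> /=; lia.
rewrite !(ev_rot_read ve' ew Sw M He') //; try by clear -ve; move=> /=; lia.
rewrite /= /upd /= Em Er Es Eq Ees.
have Et : (t %/ r = P)%N by rewrite /t divnMDl // divn_small // addn0.
have -> : (t %% r = j)%N by rewrite /t modnMDl modn_small.
rewrite Et.
have E1 : P = (((row * s2 + b) * 2 + hi) * q + i)%N by rewrite /P; ring.
have q0 : (0 < q)%N by lia.
have -> : (P %% q = i)%N by rewrite E1 modnMDl modn_small.
have -> : (P %/ (2 * m) = row)%N.
  rewrite (_ : P = row * (2 * m) + (b * (2 * q) + (hi * q + i)))%N; last by rewrite /P -Esq; ring.
  have bm : (b * (2 * q) + (hi * q + i) < 2 * m)%N.
    by rewrite -Esq [(2 * (s2 * q))%N]mulnCA ltn_mixed // ltn_mixed.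
  by rewrite divnMDl ?divn_small ?addn0 //; apply: leq_ltn_trans bm.
have -> : (P %/ q = (row * s2 + b) * 2 + hi)%N.
  by rewrite E1 divnMDl ?divn_small ?addn0.
have -> : (P %/ (2 * q) = row * s2 + b)%N.
  by rewrite /P divnMDl ?divn_small ?addn0 ?muln_gt0 // ltn_mixed.
by rewrite !modnMDl !(modn_small h2) !(modn_small bs).
Qed.

(** The last clause holds because the stored value is the result of an addition modulo [2 ^ w]. It
    allows the final cells to be recovered from their residues. *)
Lemma reduce_pass env M m r len rows :
    small env -> env 14 = m -> env 15 = r -> env 16 = (2 * r - 1)%N -> env 18 = len ->
    (0 < r)%N -> len = (rows * (m * r))%N ->
  let M' := sem w 19 env (pass 19 18 reduce_exp) M in
  (forall row i j, (row < rows)%N -> (i < m)%N -> (j < r)%N ->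
     cells M' (row * (m * r) + (i + m * j)) =
     cells M ((row * (2 * m) + i) * r + j) +
     rotate r (2 * r - 1) (fun j => cells M ((row * (2 * m) + i + m) * r + j)) j) /\
  (forall a, (a < D)%N -> M' a = M a) /\
  (forall t, (t < len)%N -> (M' (D + t) < 2 ^ w)%N).
Proof.
move=> He Em Er Eu Elen r0 Elr M'.
have [||||H1 H2] := pass_sem (w := w) ve' ew (d := 19) (len := 18) (g := reduce_exp) M _ He => //.
  by clear -ve; repeat split=> //=; lia.
split; last first.
  by split=> // t tlen; rewrite /M' H1 ?Elen // /reduce_exp ev_Add ltn_pmod ?expn_gt0.
move=> row i j rowr im jr.
have ijm : (i + m * j < m * r)%N by rewrite addnC [(m * j)%N]mulnC [(m * r)%N]mulnC ltn_mixed.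
have ltlen : (row * (m * r) + (i + m * j) < len)%N by rewrite Elr ltn_mixed.
rewrite {1}/cells /M' H1 ?Elen //; set t := (_ * (m * r) + _)%N.
have He' : small (upd (upd env 19 len) 20 t).
  by apply: small_loop => //; rewrite -Elen; apply: (proj2 He).
rewrite /reduce_exp ev_Add (natr_mod Sw) natrD.
rewrite (ev_rot_read ve' ew Sw M He') //; last by clear -ve; move=> /=; lia.
rewrite (ev_cell M He') //; last by clear -ve; move=> /=; lia.
rewrite /= /upd /= Em Er Eu.
have Et : t = ((row * r + j) * m + i)%N by rewrite /t; ring.
have -> : (t %% m = i)%N by rewrite Et modnMDl modn_small.
have -> : (t %/ m = row * r + j)%N by rewrite Et divnMDl ?divn_small ?addn0 //; lia.
have -> : (t %/ (m * r) = row)%N by rewrite /t divnMDl ?divn_small ?addn0 //; apply: leq_ltn_trans ijm.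
by rewrite modnMDl modn_small.
Qed.

End Passes.

(** * Levels of the recursion *)

(* Variables: 1 the bit length [bl] of the input, 2 the bit length of [bl],
   11 the level [l], 12 the logarithm of the row length, 13 its half [h]. *)
Definition level_lets (l len : exp) (c : cmd) : cmd :=
  Let l
  (Let (Bin OpShr (Var 1) (Var 11) + Lit 1)
  (Let (Var 12 %/ Lit 2)
  (Let (pow2 (Var 13))
  (Let (pow2 ((Var 12 + Lit 1) %/ Lit 2))
  (Let (Lit 2 * Var 15 - Lit 1)
  (Let (pow2 len) c)))))).

Definition stage_lets (s : exp) (c : cmd) : cmd :=
  Let (pow2 s) (Let (Var 14 %/ Var 20) (Let (Var 15 %/ Var 20) c)).

(** Only [h] butterfly passes for [h + 1] depths, starting at exponent 1 of [2 ^ s]: the expansion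
    has done the first. The inverse needs all [h + 1]. *)
Definition fwd_level : cmd :=
  level_lets (Var 10) (Var 1 + Lit 3 + Var 11)
    (Seq (pass 18 17 expand_exp)
         (For (Var 13) (stage_lets (Var 19 + Lit 1) (pass 23 17 fwd_exp)))).

Definition base_level : cmd :=
  Let (pow2 (Var 1 + Lit 1 + Var 2)) (pass 10 9 base_exp).

Definition inv_level : cmd :=
  level_lets (Var 2 - (Var 10 + Lit 1)) (Var 1 + Lit 2 + Var 11)
    (Seq (For (Var 13 + Lit 1) (stage_lets (Var 13 - Var 19) (pass 23 17 inv_exp)))
         (Let (Var 17 %/ Lit 2) (pass 19 18 reduce_exp))).

Definition convolution : cmd :=
  Seq (For (Var 2) fwd_level) (Seq base_level (For (Var 2) inv_level)).

Section LevelSizes.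

Variable bl : nat.

(** Closed form of halving [bl + 1] repeatedly, rounding up. It reaches 1, that is rows of length
    two, as soon as [bl < 2 ^ l]; this is why the number [L] of levels is the bit length of [bl]. *)
Definition row_log l := (bl %/ 2 ^ l).+1.
Definition half_log l := row_log l %/ 2.

Lemma row_log_next l : (row_log l + 1) %/ 2 = row_log l.+1.
Proof. by rewrite /row_log expnSr divnMA; lia. Qed.

Lemma row_log_split l : row_log l = half_log l + row_log l.+1.
Proof. by rewrite -row_log_next /half_log; lia. Qed.

(** The rounding favours the new row length [r], so that [m] divides [r] and $y^{r/m}$ can serve as
    the root of unity for length [2 * m]. *)
Lemma half_log_le l : half_log l <= row_log l.+1.
Proof. by rewrite -row_log_next /half_log; lia. Qed.

Lemma row_log_le l : row_log l <= bl.+1.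
Proof. by rewrite /row_log ltnS leq_div. Qed.

Lemma row_log0 : row_log 0 = bl.+1.
Proof. by rewrite /row_log expn0 divn1. Qed.

End LevelSizes.

Lemma row_log_last bl L : bl < 2 ^ L -> row_log bl L = 1.
Proof. by move=> H; rewrite /row_log divn_small. Qed.

Lemma log_gt0 bl L : 0 < bl -> bl < 2 ^ L -> 0 < L.
Proof. by case: L => //=; rewrite expn0; lia. Qed.

Lemma log_le bl L : 0 < bl -> 2 ^ L.-1 <= bl -> L <= bl.
Proof.
move=> bl0 le2; have lt2 : L.-1 < 2 ^ L.-1 by apply: ltn_expl.
by move: (leq_trans lt2 le2); lia.
Qed.

Lemma ev_shl1 w env M i a : ev w env M i = a -> a < w -> ev w env M (pow2 i) = 2 ^ a.
Proof.
move=> /= -> aw.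
have lt1 : 1 < 2 ^ w by rewrite -[1]/(2 ^ 0) ltn_exp2l //; lia.
by rewrite (modn_small lt1) mul1n modn_small // ltn_exp2l.
Qed.

Lemma ev_sub w env M i k a b : ev w env M i = a -> ev w env M k = b ->
  b <= a -> a < 2 ^ w -> ev w env M (i - k)%exp = a - b.
Proof. by move=> /= -> -> ba aw; rewrite -addnBAC // modnDr modn_small //; lia. Qed.

Section Levels.

Variables (w v e bl L : nat).
Hypothesis (bl_gt0 : 0 < bl) (Lbl : 2 ^ L.-1 <= bl < 2 ^ L).
Hypothesis (bv : 8 * bl <= v) (ve : 100 * v + 100 <= e) (ew : e.+2 <= w).

Notation D := (2 ^ e).
Notation row_log := (row_log bl).
Notation half_log := (half_log bl).
Notation small := (small_env v e).

Let LL : L <= bl. Proof. by apply: log_le => //; case/andP: Lbl. Qed.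

Lemma ev_small_index env M i : small env -> is_index base_var i -> index_bits v i <= e ->
  ev w env M i = evN env i.
Proof.
by move=> [_ Hi] ii li; have [] := ev_index M ii Hi (leq_trans li (ltnW (ltnW ew))).
Qed.

Definition level_env env l len : nat -> nat :=
  upd (upd (upd (upd (upd (upd (upd env 11 l) 12 (row_log l)) 13 (half_log l)) 14 (2 ^ half_log l))
    15 (2 ^ row_log l.+1)) 16 (2 * 2 ^ row_log l.+1 - 1)) 17 (2 ^ len).

Lemma small_upd_exp env i a : i != base_var -> a < v -> small env -> small (upd env i (2 ^ a)).
Proof. by move=> iD av; apply: small_env_upd => //; rewrite ltn_exp2l. Qed.

Lemma small_upd_lin env i a : i != base_var -> a < v -> small env -> small (upd env i a).
Proof.
by move=> iD av; apply: small_env_upd => //; apply: ltn_trans (ltn_expl a (isT : 1 < 2)) _; rewrite ltn_exp2l.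
Qed.

Lemma small_level_env env l len : small env -> l < L -> len < v ->
  small (level_env env l len).
Proof.
move=> He lL lenv; have LL' := LL; have K0 := row_log_le bl l; have K1 := row_log_le bl l.+1.
have Hh : half_log l <= bl.+1 by apply: leq_trans K0; rewrite row_log_split leq_addr.
rewrite /level_env.
apply: small_upd_exp => //; apply: small_env_upd => //.
  apply: (@ltn_trans (2 ^ (row_log l.+1).+1)); last by rewrite ltn_exp2l //; lia.
  by rewrite expnS; have := expn_gt0 2 (row_log l.+1); lia.
by apply: small_upd_exp => //; [lia|]; apply: small_upd_exp => //; [lia|];
  apply: small_upd_lin => //; [lia|]; apply: small_upd_lin => //; [lia|];
  apply: small_upd_lin => //; lia.
Qed.

Lemma level_run lE lenE c env M l len :
    small env -> env 1 = bl -> l < L -> ev w env M lE = l ->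
    is_index base_var lenE -> index_bits v lenE <= e -> evN (level_env env l 0) lenE = len ->
    closed_exp 12 lenE -> len < v ->
  run w 11 env (level_lets lE lenE c) M =
  add_time (exp_size lE + exp_size lenE + 25) (run w 18 (level_env env l len) c M).
Proof.
move=> He E1 lL El il bl' Elen cl lenv; rewrite /level_lets.
have LL' := LL; have K0 := row_log_le bl l; have K1 := row_log_le bl l.+1.
have Hh : half_log l <= bl.+1 by apply: leq_trans K0; rewrite row_log_split leq_addr.
have pw : forall a, a < w -> 2 ^ a < 2 ^ w by move=> a aw; rewrite ltn_exp2l.
have lw a : a < w -> a < 2 ^ w by apply: ltn_2pow.
rewrite (run_Let _ _ El).
have s1 : small (upd env 11 l) by apply: small_upd_lin => //; lia.
rewrite (@run_Let _ _ _ _ _ _ (row_log l)); last first.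
  have lt1 : 1 < 2 ^ w by apply: lw; lia.
  rewrite /= /upd /= E1 (modn_small lt1) addn1 modn_small //.
  by apply: lw; rewrite -/(row_log l); lia.
have s2 : small (upd (upd env 11 l) 12 (row_log l)) by apply: small_upd_lin => //; lia.
rewrite (@run_Let _ _ _ _ _ _ (half_log l)); last by rewrite (ev_small_index _ s2) //=; lia.
have s3 : small (upd (upd (upd env 11 l) 12 (row_log l)) 13 (half_log l)).
  by apply: small_upd_lin => //; lia.
rewrite (@run_Let _ _ _ _ _ _ (2 ^ half_log l)); last by apply: ev_shl1 => //; lia.
set env3 := upd (upd (upd env 11 l) 12 _) 13 _ in s3 *.
have s4 : small (upd env3 14 (2 ^ half_log l)) by apply: small_upd_exp => //; lia.
rewrite (@run_Let _ _ _ _ _ _ (2 ^ row_log l.+1)); last first.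
  apply: ev_shl1; last by lia.
  by rewrite (ev_small_index _ s4) //=; [exact: row_log_next|lia].
set env4 := upd env3 14 _ in s4 *.
have s5 : small (upd env4 15 (2 ^ row_log l.+1)) by apply: small_upd_exp => //; lia.
rewrite (@run_Let _ _ _ _ _ _ (2 * 2 ^ row_log l.+1 - 1)); last first.
  apply: ev_sub; first by rewrite (ev_small_index _ s5) //=; lia.
  - by rewrite /= modn_small // lw //; lia.
  - by have := expn_gt0 2 (row_log l.+1); lia.
  - by rewrite /upd /= -expnS pw //; lia.
set env5 := upd env4 15 _ in s5 *.
have s6 : small (upd env5 16 (2 * 2 ^ row_log l.+1 - 1)).
  apply: small_env_upd => //.
  apply: (@ltn_trans (2 ^ (row_log l.+1).+1)); last by rewrite ltn_exp2l //; lia.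
  by rewrite expnS; have := expn_gt0 2 (row_log l.+1); lia.
rewrite (@run_Let _ _ _ _ _ _ (2 ^ len)).
  rewrite !add_timeD /=; congr (add_time _ _); lia.
apply: ev_shl1; last by lia.
rewrite (ev_small_index _ s6) // -Elen.
elim: lenE cl {il bl' Elen} => //= [i i12|o a IHa b IHb /andP[ca cb]].
  by rewrite /level_env /upd; do !case: eqP => //; lia.
by case: o => //=; rewrite IHa ?IHb.
Qed.

Lemma level_sem lE lenE c env M l len :
    small env -> env 1 = bl -> l < L -> ev w env M lE = l ->
    is_index base_var lenE -> index_bits v lenE <= e -> evN (level_env env l 0) lenE = len ->
    closed_exp 12 lenE -> len < v ->
  sem w 11 env (level_lets lE lenE c) M = sem w 18 (level_env env l len) c M.
Proof.
by move=> He E1 lL El il bl' Elen cl lenv;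
  have [] := level_run c He E1 lL El il bl' Elen cl lenv.
Qed.

Definition stage_env env s m r : nat -> nat :=
  upd (upd (upd env 20 (2 ^ s)) 21 (m %/ 2 ^ s)) 22 (r %/ 2 ^ s).

Lemma stage_run sE c env M s m r : small env -> env 14 = m -> env 15 = r ->
    s < v -> ev w env M sE = s ->
  run w 20 env (stage_lets sE c) M =
  add_time (exp_size sE + 8) (run w 23 (stage_env env s m r) c M).
Proof.
move=> He Em Er sv Es; rewrite /stage_lets.
rewrite (@run_Let _ _ _ _ _ _ (2 ^ s)); last by apply: ev_shl1 => //; lia.
rewrite (@run_Let _ _ _ _ _ _ (m %/ 2 ^ s)); last by rewrite /= /upd /= Em.
rewrite (@run_Let _ _ _ _ _ _ (r %/ 2 ^ s)); last by rewrite /= /upd /= Er.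
by rewrite !add_timeD /=; congr (add_time _ _); lia.
Qed.

Lemma stage_sem sE c env M s m r : small env -> env 14 = m -> env 15 = r ->
    s < v -> ev w env M sE = s ->
  sem w 20 env (stage_lets sE c) M = sem w 23 (stage_env env s m r) c M.
Proof. by move=> He Em Er sv Es; have [] := stage_run c He Em Er sv Es. Qed.

Lemma small_stage_env env s m r : small env -> env 14 = m -> env 15 = r -> s < v ->
  small (stage_env env s m r).
Proof.
move=> He Em Er sv; have [_ Hi] := He; rewrite /stage_env.
apply: small_env_upd => //.
  by apply: leq_ltn_trans (leq_div _ _) _; rewrite -Er; apply: Hi.
apply: small_env_upd => //; last exact: small_upd_exp.
by apply: leq_ltn_trans (leq_div _ _) _; rewrite -Em; apply: Hi.
Qed.

End Levels.


(** * One level of the recursion, forwards and backwards *)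

Section LevelSpec.

Import GRing.Theory.
Local Open Scope ring_scope.

Variables (w v e bl L : nat).
Hypothesis (bl_gt0 : (0 < bl)%N) (Lbl : (2 ^ L.-1 <= bl < 2 ^ L)%N).
Hypothesis (bv : (8 * bl <= v)%N) (ve : (100 * v + 100 <= e)%N) (ew : (e.+2 <= w)%N).
Variable S : comNzRingType.
Hypothesis Sw : (2 ^ w)%:R = 0 :> S.

Notation D := (2 ^ e)%N.
Notation small := (small_env v e).
Notation cells := (@cells e S).
Notation row_log := (row_log bl).
Notation half_log := (half_log bl).

Lemma sum_interleave m r (F : nat -> S) :
  \sum_(t < m * r) F t = \sum_(i < m) \sum_(j < r) F (i + m * j)%N.
Proof.
elim: r => [|r IH]; first by rewrite muln0 big_ord0 big1 // => i _; rewrite big_ord0.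
rewrite mulnS addnC big_split_ord /= IH.
rewrite [RHS](eq_bigr (fun i : 'I_m => \sum_(j < r) F (i + m * j)%N + F (m * r + i)%N)).
  by rewrite big_split.
by move=> i _; rewrite big_ord_recr /= addnC.
Qed.

Definition coef m r (y : S) (a : nat -> S) row i : S :=
  \sum_(j < r) a (row * (m * r) + (i + m * j))%N * y ^+ j.

Lemma rowval_coef m r x a row :
  rowval (m * r) x a row = \sum_(i < m) coef m r (x ^+ m) a row i * x ^+ i.
Proof.
rewrite /rowval (sum_interleave m r (fun t => a (row * (m * r) + t)%N * x ^+ t)).
apply: eq_bigr => i _; rewrite mulr_suml; apply: eq_bigr => j _.
by rewrite exprD exprM; ring.
Qed.

(** As a root of unity, [y] is invertible even where 2 is not. *)
Lemma mulX_inj r (y a b : S) c : (0 < r)%N -> y ^+ r = -1 ->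
  y ^+ c * a = y ^+ c * b -> a = b.
Proof.
move=> r0 yr  /(congr1 ( *%R (y ^+ (2 * r * c - c)))); rewrite !mulrA -!exprD subnK.
  by rewrite exprM (expr2r yr) expr1n !mul1r.
by rewrite leq_pmull // muln_gt0.
Qed.

(** [R] counts the rows of both operands together: their [2 ^ (bl + 2)] cells have been doubled by
    each of the [l] earlier levels. *)
Lemma fwd_level_spec env M l x R :
    small env -> env 1 = bl -> (l < L)%N -> env 10 = l ->
    (R * 2 ^ row_log l = 2 ^ (bl + 2 + l))%N -> x ^+ (2 ^ row_log l) = -1 ->
  let m := (2 ^ half_log l)%N in let r := (2 ^ row_log l.+1)%N in let y := x ^+ m in
  let M' := sem w 11 env fwd_level M in
  (forall row b, (row < R)%N -> (b < 2 * m)%N ->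
     rowval r y (cells M') (row * (2 * m) + b) =
     \sum_(i < m) coef m r y (cells M) row i * (y ^+ (b * (r %/ m))) ^+ i) /\
  (forall a, (a < D)%N -> M' a = M a).
Proof.
move=> He E1 lL E10 ER xn m r y M'.
have LL : (L <= bl)%N by apply: log_le => //; case/andP: Lbl.
have K0 := row_log_le bl l; have K1 := row_log_le bl l.+1; have Ks := row_log_split bl l.
have r0 : (0 < r)%N by rewrite expn_gt0.
have Emr : (m * r = 2 ^ row_log l)%N by rewrite Ks expnD.
have yr : y ^+ r = -1 by rewrite -exprM Emr.
have hr : (m %| r)%N by rewrite dvdn_exp2l // half_log_le.
set len := (bl + 3 + l)%N.
have lenv : (len < v)%N by rewrite /len; lia.
have Elen : (2 ^ len = R * (2 * m) * r)%N.
  have -> : len = (bl + 2 + l).+1 by rewrite /len; lia.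
  by rewrite expnS -ER -Emr; ring.
have lsem c : sem w 11 env (level_lets (Var 10) (Var 1 + Lit 3 + Var 11) c) M =
    sem w 18 (level_env bl env l len) c M.
  apply: (@level_sem _ _ _ _ _ bl_gt0 Lbl bv ve ew (Var 10) (Var 1 + Lit 3 + Var 11) c
    env M l len He E1 lL E10 isT _ _ isT lenv).
    by clear -bv ve bl_gt0; move=> /=; lia.
  by rewrite /= /level_env /upd /= E1.
rewrite /M' /fwd_level {}lsem sem_Seq.
have sl := small_level_env bl_gt0 Lbl bv ve ew He lL lenv.
set env' := level_env _ _ _ _ in sl *.
have [H1 H2] := expand_pass (w := w) ve ew S M
  (m := m) (r := r) (len := (2 ^ len)%N) sl erefl erefl erefl r0.
set M1 := sem _ _ _ _ _ in H1 H2 *.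
(* After [s] passes the array holds the remainders at depth [s.+1]; the expansion supplies the case
   [s = 0]. *)
pose P s M2 := (forall row b i, (row < R)%N -> (b < 2 ^ s.+1)%N -> (i < 2 ^ (half_log l - s))%N ->
  rowval r y (cells M2) ((row * 2 ^ s.+1 + b) * 2 ^ (half_log l - s) + i) =
  node (half_log l) r y (padded m (coef m r y (cells M) row)) s.+1 b i) /\
  (forall a, (a < D)%N -> M2 a = M a).
suff [H3 H4] : P (half_log l) (sem w 18 env' (For (Var 13) (stage_lets (Var 19 + Lit 1) (pass 23 17 fwd_exp))) M1).
  split=> // row b rowR b2m.
  have := H3 row b 0%N rowR; rewrite expnS subnn expn0 muln1 addn0 => -> //.
  by rewrite node_leaf // expnS mul2n -addnn padded_eval.
rewrite (@sem_For _ _ _ _ _ _ (half_log l)) //; last first.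
  by apply: (@ltn_exp2 v); [apply: (proj2 sl 13) | lia].
apply: (iteri_ind (Q := P)).
  split=> // row b i rowR b2 im; rewrite /rowval subn0 in im *.
  rewrite /= subn0 /padded im ltnNge leq_addl /= mulr0 addr0; apply: eq_bigr => -[j jr] _ /=.
  rewrite -/m H1 //.
  rewrite Elen ltn_mixed //; have -> : (R * (2 * m) = R * 2 * m)%N by ring.
  by rewrite !ltn_mixed.
move=> s M2 sh [HP1 HP2].
set env2 := upd (upd env' 18 _) 19 _.
have Hh : (half_log l <= bl.+1)%N by apply: leq_trans K0; rewrite Ks leq_addr.
have s2 : small env2.
  by apply: small_upd_lin => //; [lia|]; apply: small_upd_lin => //; lia.
have sv : (s.+1 < v)%N by lia.
have Es : ev w env2 M2 (Var 19 + Lit 1)%exp = s.+1.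
  rewrite (ev_small_index ew _ s2); [exact: addn1 | by [] | by clear -bv ve bl_gt0; move=> /=; lia].
rewrite (stage_sem bl_gt0 Lbl bv ve ew _ s2 (erefl m) (erefl r) sv Es).
have s3 := small_stage_env s2 (erefl m) (erefl r) sv.
have Eq : (m %/ 2 ^ s.+1 = 2 ^ (half_log l - s.+1))%N.
  by rewrite -expnB // ?leqW //.
have Esq : (2 ^ s.+1 * 2 ^ (half_log l - s.+1) = m)%N by rewrite -expnD subnKC.
have [H5 H6] := fwd_pass ve ew Sw M2 (m := m) (r := r)
  (s2 := (2 ^ s.+1)%N) (q := (2 ^ (half_log l - s.+1))%N) (es := (r %/ 2 ^ s.+1)%N)
  (rows := (R * (2 * m))%N) s3 erefl erefl erefl erefl erefl Eq erefl r0 Esq Elen yr.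
split; last by move=> a aD; rewrite H6 // HP2.
move=> row b i rowR; rewrite [(2 ^ s.+2)%N]expnS => b2 iq.
have rowb : ((row * (2 * 2 ^ s.+1) + b) * 2 ^ (half_log l - s.+1) + i < R * (2 * m))%N.
  by rewrite -Esq !mulnA -[(_ * 2 * _)%N]mulnA -(mulnA R) ltn_mixed // ltn_mixed.
rewrite H5 //.
have E2q : (2 ^ (half_log l - s) = 2 * 2 ^ (half_log l - s.+1))%N by rewrite -expnS subnSK.
have Eb : (row * (2 * m) + (b %% 2 ^ s.+1 * (2 * 2 ^ (half_log l - s.+1)) + i) =
   (row * 2 ^ s.+1 + b %% 2 ^ s.+1) * 2 ^ (half_log l - s) + i)%N.
  by rewrite E2q -Esq; ring.
rewrite Eb -addnA !HP1 //; try by rewrite ?ltn_pmod ?expn_gt0 // E2q; clear -iq; lia.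
Qed.

(** Interpolation of any [g] from its values at [2 * m] roots of unity. [kap] is the scale inherited
    from the deeper levels; each of the [h + 1] inverse butterflies adds a factor 2. *)
Lemma inv_level_spec env M l l' (x : S) R (g : nat -> nat -> S) kap :
    small env -> env 1 = bl -> env 2 = L -> (l' < L)%N -> env 10 = l' -> (L - l'.+1 = l)%N ->
    (R * 2 ^ row_log l = 2 ^ (bl + 1 + l))%N -> x ^+ (2 ^ row_log l) = -1 ->
    let m := (2 ^ half_log l)%N in let r := (2 ^ row_log l.+1)%N in let y := x ^+ m in
    (forall row b, (row < R)%N -> (b < 2 * m)%N ->
     rowval r y (cells M) (row * (2 * m) + b) =
     kap * \sum_(i < m + m) g row i * (y ^+ (b * (r %/ m))) ^+ i) ->
  let M' := sem w 11 env inv_level M in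
  [/\ forall row, (row < R)%N ->
       rowval (2 ^ row_log l) x (cells M') row =
       kap * 2 ^+ (half_log l).+1 * \sum_(i < m + m) g row i * x ^+ i,
      forall a, (a < D)%N -> M' a = M a
    & forall t, (t < R * 2 ^ row_log l)%N -> (M' (D + t) < 2 ^ w)%N].
Proof.
move=> He E1 E2 lL' E10 El ER xn m r y HM M'.
have lL : (l < L)%N by lia.
have LL : (L <= bl)%N by apply: log_le => //; case/andP: Lbl.
have K0 := row_log_le bl l; have K1 := row_log_le bl l.+1; have Ks := row_log_split bl l.
have Hh : (half_log l <= bl.+1)%N by apply: leq_trans K0; rewrite Ks leq_addr.
have r0 : (0 < r)%N by rewrite expn_gt0.
have Emr : (m * r = 2 ^ row_log l)%N by rewrite Ks expnD.
have yr : y ^+ r = -1 by rewrite -exprM Emr.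
have hr : (m %| r)%N by rewrite dvdn_exp2l // half_log_le.
have lw a : (a < w)%N -> (a < 2 ^ w)%N by apply: ltn_2pow.
set len := (bl + 2 + l)%N.
have lenv : (len < v)%N by rewrite /len; lia.
have Elen : (2 ^ len = R * (2 * m) * r)%N.
  have -> : len = (bl + 1 + l).+1 by rewrite /len; lia.
  by rewrite expnS -ER -Emr; ring.
have lsem c : sem w 11 env (level_lets (Var 2 - (Var 10 + Lit 1)) (Var 1 + Lit 2 + Var 11) c) M =
    sem w 18 (level_env bl env l len) c M.
  have ElE : ev w env M (Var 2 - (Var 10 + Lit 1))%exp = l.
    rewrite -El; apply: ev_sub.
    - exact: E2.
    - rewrite (ev_small_index ew _ He); [ | by [] | by clear -bv ve bl_gt0; move=> /=; lia].
      by rewrite /= E10 addn1.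
    - by lia.
    - by apply: lw; lia.
  apply: (@level_sem _ _ _ _ _ bl_gt0 Lbl bv ve ew _ (Var 1 + Lit 2 + Var 11) c
    env M l len He E1 lL ElE isT _ _ isT lenv).
    by clear -bv ve bl_gt0; move=> /=; lia.
  by rewrite /= /level_env /upd /= E1.
rewrite /M' /inv_level {}lsem sem_Seq.
have sl := small_level_env bl_gt0 Lbl bv ve ew He lL lenv.
set env' := level_env _ _ _ _ in sl *.
(* After [s] passes one has climbed from the leaves to depth [h.+1 - s], at the price of
   [2 ^+ s]. *)
pose P s M2 := (forall row b i, (row < R)%N -> (b < 2 ^ ((half_log l).+1 - s))%N -> (i < 2 ^ s)%N ->
  rowval r y (cells M2) ((row * 2 ^ ((half_log l).+1 - s) + b) * 2 ^ s + i) =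
  kap * 2 ^+ s * node (half_log l) r y (g row) ((half_log l).+1 - s) b i) /\
  (forall a, (a < D)%N -> M2 a = M a).
have [] : P (half_log l).+1 (sem w 18 env' (For (Var 13 + Lit 1)
    (stage_lets (Var 13 - Var 19) (pass 23 17 inv_exp))) M).
  rewrite (@sem_For _ _ _ _ _ _ (half_log l).+1); last 2 first.
  - rewrite (ev_small_index ew _ sl); [exact: addn1 | by [] | by clear -bv ve bl_gt0; move=> /=; lia].
  - by apply: lw; lia.
  apply: (iteri_ind (Q := P)).
    split=> // row b i rowR; rewrite subn0 expn0 muln1 => b2; rewrite ltnS leqn0 => /eqP ->.
    rewrite addn0 expnS HM //; last by rewrite -expnS.
    by rewrite node_leaf // expr0 mulr1 expnS mul2n -addnn.
  move=> s M2 sh [HP1 HP2].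
  set env2 := upd (upd env' 18 _) 19 _.
  have s2 : small env2.
    by apply: small_upd_lin => //; [lia|]; apply: small_upd_lin => //; lia.
  have sv : (half_log l - s < v)%N by lia.
  have Es : ev w env2 M2 (Var 13 - Var 19)%exp = (half_log l - s)%N.
    apply: (ev_sub (a := half_log l) (b := s)) => //.
    by apply: lw; lia.
  rewrite (stage_sem bl_gt0 Lbl bv ve ew _ s2 (erefl m) (erefl r) sv Es).
  have s3 := small_stage_env s2 (erefl m) (erefl r) sv.
  have leh : (half_log l - s <= half_log l)%N by apply: leq_subr.
  have Eq : (m %/ 2 ^ (half_log l - s) = 2 ^ s)%N.
    by rewrite -expnB // subKn.
  have Esq : (2 ^ (half_log l - s) * 2 ^ s = m)%N by rewrite -expnD subnK.
  have [H5 H6] := inv_pass ve ew Sw M2 (m := m) (r := r)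
    (s2 := (2 ^ (half_log l - s))%N) (q := (2 ^ s)%N) (es := (r %/ 2 ^ (half_log l - s))%N)
    (rows := (R * (2 * m))%N) s3 erefl erefl erefl erefl Eq erefl r0 Esq Elen yr.
  split; last by move=> a aD; rewrite H6 // HP2.
  have Ed : ((half_log l).+1 - s = (half_log l - s).+1)%N by rewrite subSn.
  move: HP1; rewrite Ed subSS => HP1 row b I rowR b2 Iq.
  set d := (half_log l - s)%N in b2 Eq Esq H5 HP1 leh *; set q := (2 ^ s)%N in Eq Esq H5 HP1 Iq *.
  have q0 : (0 < q)%N by rewrite expn_gt0.
  have dr : (2 ^ d %| r)%N by apply: dvdn_trans hr; apply: dvdn_exp2l.
  rewrite expnS -/q in Iq *.
  rewrite (divn_eq I q); set hi := (I %/ q)%N; set i := (I %% q)%N.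
  have hi2 : (hi < 2)%N by rewrite ltn_divLR.
  have iq : (i < q)%N by rewrite ltn_pmod.
  have rowb : ((row * 2 ^ d + b) * (2 * q) + (hi * q + i) < R * (2 * m))%N.
    have -> : (R * (2 * m) = R * 2 ^ d * (2 * q))%N by rewrite -Esq; ring.
    by rewrite ltn_mixed // ltn_mixed.
  have := H5 row b hi i b2 hi2 iq rowb.
  have Eb c : (row * (2 * m) + (c * q + i) = (row * 2 ^ d.+1 + c) * q + i)%N.
    by rewrite -Esq expnS; ring.
  have -> : (row * (2 * m) + (b * q + i) + m = (row * 2 ^ d.+1 + (b + 2 ^ d)) * q + i)%N.
    by rewrite -Esq expnS; ring.
  have b2' : (b + 2 ^ d < 2 ^ d.+1)%N by rewrite expnS mul2n -addnn ltn_add2r.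
  have b2'' : (b < 2 ^ d.+1)%N by apply: ltn_trans b2 _; rewrite ltn_exp2l.
  rewrite Eb !HP1 //.
  have [Ep Em] := node_pair (half_log l) (g row) i b2 dr yr.
  have Ehd : (2 ^ (half_log l - d) = q)%N by rewrite subKn //; lia.
  rewrite exprS; case: hi hi2 {rowb} => [|[|//]] _.
    rewrite !mul0n !expr0 !mul1r add0n -mulrDr Ep => ->; ring.
  rewrite !mul1n expr1 mulN1r -mulrBr Em Ehd => HH.
  apply: (mulX_inj r0 yr (c := (b * (r %/ 2 ^ d))%N)); rewrite {}HH [(i + q)%N]addnC; ring.
set M1 := sem _ _ _ (For _ _) _ => H3 H4.
have Elen2 : (2 ^ len %/ 2 = R * (m * r))%N.
  by rewrite Elen -[RHS](mulKn _ (isT : 0 < 2)%N); congr (_ %/ _)%N; ring.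
rewrite (@sem_Let _ _ _ _ _ _ (R * (m * r))%N); last first.
  rewrite (ev_small_index ew _ sl); [exact: Elen2 | by [] | by clear -bv ve bl_gt0; move=> /=; lia].
have s5 : small (upd env' 18 (R * (m * r))%N).
  apply: small_env_upd => //; rewrite -Elen2; apply: leq_ltn_trans (leq_div _ _) _.
  by rewrite ltn_exp2l.
have [H5 [H6 H7]] := reduce_pass ve ew Sw M1 (m := m) (r := r)
  s5 erefl erefl erefl erefl r0 erefl.
split; last by rewrite -Emr.
- move=> row rowR; rewrite -{1}Emr rowval_coef -/y big_split_ord /= -big_split mulr_sumr /=.
  apply: eq_bigr => -[i im] _ /=.
  have -> : coef m r y (cells (sem w 19 (upd env' 18 (R * (m * r))) (pass 19 18 reduce_exp) M1)) row i =
      rowval r y (cells M1) (row * (2 * m) + i) +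
      y * rowval r y (cells M1) (row * (2 * m) + i + m).
    rewrite -[X in X * rowval _ _ _ (_ + m)]expr1 /rowval.
    rewrite -(rotate_mulX 1 (fun j => cells M1 ((row * (2 * m) + i + m) * r + j)) r0 yr) muln1.
    rewrite -big_split; apply: eq_bigr => -[j jr] _ /=.
    by rewrite H5 // mulrDl.
  have H8 c : (c < 2 * m)%N -> rowval r y (cells M1) (row * (2 * m) + c) =
      kap * 2 ^+ (half_log l).+1 * g row c.
    move=> c2; have := H3 row 0%N c rowR; rewrite subnn expn0 muln1 addn0.
    by rewrite -expnS in c2 *; move=> -> //; rewrite expnS.
  rewrite -addnA !H8; [|by lia|by lia].
  by rewrite /y exprD [(m + i)%N]addnC; ring.
- by move=> a aD; rewrite H6 // H4.
Qed.

End LevelSpec.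

(** * Negacyclic convolution *)

Section ConvolutionSpec.

Import GRing.Theory.
Local Open Scope ring_scope.

Variables (w v e bl L : nat).
Hypothesis (bl_gt0 : (0 < bl)%N) (Lbl : (2 ^ L.-1 <= bl < 2 ^ L)%N).
Hypothesis (bv : (8 * bl <= v)%N) (ve : (100 * v + 100 <= e)%N) (ew : (e.+2 <= w)%N).
Variable S : comNzRingType.
Hypothesis Sw : (2 ^ w)%:R = 0 :> S.

Notation D := (2 ^ e)%N.
Notation small := (small_env v e).
Notation cells := (@cells e S).
Notation row_log := (row_log bl).
Notation half_log := (half_log bl).

Fixpoint root_at (x : S) l : S :=
  if l is l'.+1 then root_at x l' ^+ (2 ^ half_log l') else x.

Lemma root_atP x l : x ^+ (2 ^ bl.+1) = -1 -> root_at x l ^+ (2 ^ row_log l) = -1.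
Proof.
move=> xn; elim: l => [|l IH] /=; first by rewrite row_log0.
by rewrite -exprM -expnD -row_log_split.
Qed.

(** Undoing level [l] costs the factor [2 ^+ (half_log l).+1]. The half logarithms telescope to
    [row_log 0 - row_log L = bl], and the successors contribute [L] more. *)
Lemma convolution_spec env M x :
    small env -> env 1 = bl -> env 2 = L -> x ^+ (2 ^ bl.+1) = -1 ->
  let M' := sem w 9 env convolution M in
  [/\ rowval (2 ^ bl.+1) x (cells M') 0 =
      2 ^+ (bl + L) * (rowval (2 ^ bl.+1) x (cells M) 0 * rowval (2 ^ bl.+1) x (cells M) 1),
      forall a, (a < D)%N -> M' a = M a
    & forall t, (t < 2 ^ bl.+1)%N -> (M' (D + t) < 2 ^ w)%N].
Proof.
move=> He E1 E2 xn M'.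
have LL : (L <= bl)%N by apply: log_le => //; case/andP: Lbl.
have L0 : (0 < L)%N by apply: (log_gt0 bl_gt0); case/andP: Lbl.
have Lw : (L < 2 ^ w)%N by apply: ltn_2pow; lia.
have senv l : (l < L)%N -> small (upd (upd env 9 L) 10 l).
  by move=> lL; apply: small_upd_lin => //; [lia|]; apply: small_upd_lin => //; lia.
pose fbody l := sem w 11 (upd (upd env 9 L) 10 l) fwd_level.
pose ibody l := sem w 11 (upd (upd env 9 L) 10 l) inv_level.
pose A l := iteri l fbody M.
pose B := sem w 9 env base_level (A L).
pose C k := iteri k ibody B.
have EM' : M' = C L.
  by rewrite /M' /convolution !sem_Seq !(@sem_For _ _ _ _ _ _ L).
pose R l := (2 ^ (bl + 1 + l - row_log l))%N.
have ER l : (R l * 2 ^ row_log l = 2 ^ (bl + 1 + l))%N.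
  by rewrite -expnD subnK //; have := row_log_le bl l; lia.
have ER2 l : ((R l + R l) * 2 ^ row_log l = 2 ^ (bl + 2 + l))%N.
  by rewrite mulnDl ER addnn -mul2n -expnS; congr (2 ^ _)%N; lia.
have HAf a l : (l <= L)%N -> (a < D)%N -> A l a = M a.
  move=> + aD; elim: l => // l IH lL.
  apply: etrans (IH (ltnW lL)).
  have [_ Hf] := fwd_level_spec bl_gt0 Lbl bv ve ew Sw (A l) (senv l lL) E1 lL erefl (ER2 l) (root_atP l xn).
  exact: Hf.
(* [A l] is the array entering forward level [l], with [R l] rows per operand. Undoing [k] levels
   leaves, in each row, the scaled product of the corresponding rows of the two operands in
   [A (L - k)]. *)
have key k : (k <= L)%N -> let l := (L - k)%N in
    [/\ forall row, (row < R l)%N ->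
      rowval (2 ^ row_log l) (root_at x l) (cells (C k)) row =
      2 ^+ ((row_log l).-1 + k) * (rowval (2 ^ row_log l) (root_at x l) (cells (A l)) row *
        rowval (2 ^ row_log l) (root_at x l) (cells (A l)) (R l + row)),
      forall a, (a < D)%N -> C k a = M a
    & (0 < k)%N -> forall t, (t < R l * 2 ^ row_log l)%N -> (C k (D + t) < 2 ^ w)%N].
  elim: k => [_|k IH kL].
    have klL1 : row_log L = 1%N by apply: row_log_last; case/andP: Lbl.
    have EL : (2 ^ (bl + 1 + L) = R L * 2)%N by rewrite -ER klL1.
    have sb : small (upd env 9 (2 ^ (bl + 1 + L))%N) by apply: small_upd_exp => //; lia.
    have y2 : root_at x L ^+ 2 = -1 by have := root_atP L xn; rewrite klL1.
    have [H1 H2] := base_pass ve ew Sw (A L) sb erefl EL y2.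
    have EB : B = sem w 10 (upd env 9 (2 ^ (bl + 1 + L))) (pass 10 9 base_exp) (A L).
      rewrite /B /base_level (@sem_Let _ _ _ _ _ _ (2 ^ (bl + 1 + L))%N) //.
      apply: ev_shl1; last by lia.
      rewrite (ev_small_index ew _ He); [ | by [] | by clear -bv ve bl_gt0; move=> /=; lia].
      by rewrite /= E1 E2.
    rewrite subn0; split=> //; last by move=> a aD; rewrite /C /= EB H2 // HAf.
    by move=> row rowR; rewrite klL1 expr0 mul1r /C /= EB H1.
  have [IH1 IH2 _] := IH (ltnW kL).
  set l := (L - k.+1)%N; have El : (L - k = l.+1)%N by rewrite /l; lia.
  rewrite El in IH1.
  have lL : (l < L)%N by rewrite /l; lia.
  have [F1 _] := fwd_level_spec bl_gt0 Lbl bv ve ew Sw (A l) (senv l lL) E1 lL erefl (ER2 l) (root_atP l xn).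
  have Hm : (R l.+1 = R l * (2 * 2 ^ half_log l))%N.
    rewrite /R -expnS -expnD; congr (2 ^ _)%N.
    by have := row_log_split bl l; have := row_log_le bl l; have := row_log_le bl l.+1; lia.
  have [|I1 I2 I3] := inv_level_spec bl_gt0 Lbl bv ve ew Sw (l := l) (g := fun row =>
      product (2 ^ half_log l) (coef (2 ^ half_log l) (2 ^ row_log l.+1) (root_at x l ^+ (2 ^ half_log l)) (cells (A l)) row)
       (coef (2 ^ half_log l) (2 ^ row_log l.+1) (root_at x l ^+ (2 ^ half_log l)) (cells (A l)) (R l + row)))
    (kap := 2 ^+ ((row_log l.+1).-1 + k)) (M := C k)
    (senv k kL) E1 E2 kL erefl erefl (ER l) (root_atP l xn).
    move=> row b rowR b2.
    rewrite IH1; last by rewrite Hm ltn_mixed.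
    rewrite Hm product_eval addnA -mulnDl.
    have -> : A l.+1 = sem w 11 (upd (upd env 9 L) 10 l) fwd_level (A l) by [].
    by rewrite !F1 // ?ltn_add2l //; lia.
  split=> //.
  - move=> row rowR; rewrite [C _]/(ibody k (C k)) I1 // product_eval.
    have Ek : (2 ^ row_log l = 2 ^ half_log l * 2 ^ row_log l.+1)%N by rewrite -expnD -row_log_split.
    rewrite Ek !rowval_coef -exprD; congr (2 ^+ _ * _).
    have kpos : (0 < row_log l.+1)%N by [].
    by have := row_log_split bl l; lia.
  - by move=> a aD; rewrite [C _]/(ibody k (C k)) I2 // IH2.
have [] := key L (leqnn L); rewrite subnn row_log0.
have -> : R 0%N = 1%N by rewrite /R row_log0 addn0 addn1 subnn.
move=> K1 K2 K3; rewrite EM'; split=> //.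
- by rewrite K1.
- by move=> t; rewrite -[X in (_ < X)%N]mul1n; apply: K3.
Qed.

End ConvolutionSpec.


(** * Polynomials modulo $X^n+1$ *)

Section Negacyclic.

Import GRing.Theory.
Local Open Scope ring_scope.

Variables (A : comNzRingType) (n : nat).
Hypothesis n_gt0 : (0 < n)%N.

Definition negacyclic : {poly A} := 'X^n + 1%:P.

Lemma negacyclic_size : size negacyclic = n.+1.
Proof. by rewrite size_polyDl size_polyXn // size_polyC oner_eq0. Qed.

Lemma negacyclic_monic : negacyclic \is monic.
Proof.
by rewrite monicE lead_coefDl ?lead_coefXn // size_polyXn size_polyC oner_eq0.
Qed.

Lemma mk_monic_negacyclic : mk_monic negacyclic = negacyclic.
Proof. by rewrite /mk_monic negacyclic_size negacyclic_monic ltnS n_gt0. Qed.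

(** The generic choice of [x]: the value of a row at the class of $X$ is the class of the polynomial
    of the row, and below degree [n] that class determines the coefficients. *)
Definition root_elt : {poly %/ negacyclic} := in_qpoly negacyclic 'X.

Lemma root_elt_exp : root_elt ^+ n = -1.
Proof.
apply/eqP; rewrite -subr_eq0 opprK -rmorphXn -[1](rmorph1 (in_qpoly negacyclic)) -rmorphD.
apply/eqP/val_inj => /=; rewrite mk_monic_negacyclic -[1 in X in _ + X]/(1%:P).
by rewrite Pdiv.RingMonic.rmodpp ?negacyclic_monic.
Qed.

Lemma rowval_qpoly (a : nat -> nat) p :
  rowval n root_elt (fun t => (a t)%:R) p =
  in_qpoly negacyclic (\poly_(t < n) (a (p * n + t)%N)%:R).
Proof.
rewrite poly_def rmorph_sum; apply: eq_bigr => t _.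
by rewrite -mul_polyC rmorphM rmorphXn polyCMn rmorph_nat.
Qed.

Lemma in_qpoly_inj (p q : {poly A}) : (size p <= n)%N -> (size q <= n)%N ->
  in_qpoly negacyclic p = in_qpoly negacyclic q -> p = q.
Proof.
by move=> sp sq /(congr1 val) /=; rewrite mk_monic_negacyclic !Pdiv.CommonRing.rmodp_small // negacyclic_size.
Qed.

End Negacyclic.

Section Sumset.

Import GRing.Theory.

Variables (w v e bl L : nat).
Hypothesis (bl_gt0 : 0 < bl) (Lbl : 2 ^ L.-1 <= bl < 2 ^ L).
Hypothesis (bv : 8 * bl <= v) (ve : 100 * v + 100 <= e) (ew : e.+2 <= w).

Notation D := (2 ^ e).
Notation n := (2 ^ bl.+1).

(** Coefficient [t] of the product of the two indicator polynomials counts the representations of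
    [t] as a sum, so its support is the sumset. *)
Lemma convolution_sumset env (M : nat -> nat) (a b : nat -> bool) :
    small_env v e env -> env 1 = bl -> env 2 = L ->
    (forall t, t < n -> M (D + t) = a t) ->
    (forall t, t < n -> M (D + (n + t)) = b t) ->
    (forall t, 2 ^ bl <= t -> a t = false) -> (forall t, 2 ^ bl <= t -> b t = false) ->
  let M' := sem w 9 env convolution M in
  (forall t, t < n -> (0 < M' (D + t)) = [exists i : 'I_t.+1, a i && b (t - i)]) /\
  (forall c, c < D -> M' c = M c).
Proof.
move=> He E1 E2 Ma Mb a0 b0 M'.
have n0 : 0 < n by rewrite expn_gt0.
have w1 : 1 < 2 ^ w by rewrite -[1]/(2 ^ 0) ltn_exp2l //; lia.
pose A := 'Z_(2 ^ w).
have Aw : ((2 ^ w)%:R = 0 :> A)%R by apply: val_inj; rewrite /= val_Zp_nat // modnn.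
have Sw : ((2 ^ w)%:R = 0 :> {poly %/ negacyclic A n})%R.
  by rewrite -(rmorph_nat (in_qpoly (negacyclic A n))) -polyCMn Aw rmorph0.
have [H1 H2 H3] := convolution_spec bl_gt0 Lbl bv ve ew Sw M He E1 E2 (root_elt_exp A n0).
split=> // t tn.
move: H1; rewrite -/M' /cells (rowval_qpoly A n (fun t => M' (D + t))).
rewrite !(rowval_qpoly A n (fun t => M (D + t))); set PC := (\poly_(_ < _) _)%R; set PA := (\poly_(_ < _) _)%R; set PB := (\poly_(_ < _) _)%R.
have sA : size PA <= 2 ^ bl.
  apply/leq_sizeP => j jb; rewrite coef_poly; case: ifP => // jn.
  by rewrite mul0n add0n Ma // a0.
have sB : size PB <= 2 ^ bl.
  apply/leq_sizeP => j jb; rewrite coef_poly; case: ifP => // jn.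
  by rewrite mul1n Mb // b0.
(* Both operands live below [n / 2], so the product does not wrap around modulo $X^n+1$. *)
have sAB : size (PA * PB)%R <= n.
  apply: leq_trans (size_polyMleq _ _) _; rewrite expnS mul2n -addnn.
  by apply: leq_trans (leq_pred _) _; apply: leq_add.
have sABk k : size (PA * PB *+ k)%R <= n.
  by apply/leq_sizeP => j jn; rewrite coefMn (leq_sizeP _ _ sAB j jn) mul0rn.
rewrite -!rmorphM -(rmorph_nat (in_qpoly (negacyclic A n))) -rmorphXn -rmorphM.
move/in_qpoly_inj => /(_ n0 (size_poly _ _)).
rewrite -natrX mulr_natl => /(_ (sABk _)) /(congr1 (fun p : {poly A} => p`_t))%R.
rewrite coefMn coef_poly tn mul0n add0n coefM.
have -> : (\sum_(j < t.+1) PA`_j * PB`_(t - j) = (\sum_(j < t.+1) (a j && b (t - j)))%:R :> A)%R.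
  rewrite natr_sum; apply: eq_bigr => -[j jt] _ /=.
  have jn : j < n by lia.
  have tjn : t - j < n by lia.
  by rewrite !coef_poly jn tjn mul0n add0n mul1n Ma // Mb // -natrM mulnb.
rewrite -mulrnA => /(congr1 val) /=; rewrite !val_Zp_nat //.
rewrite modn_small ?H3 //.
set s := \sum_(j < t.+1) _; set k := 2 ^ (bl + L).
have sn : s <= n.
  apply: leq_trans (_ : \sum_(j < t.+1) 1 <= n); last by rewrite sum1_card card_ord.
  by apply: leq_sum => j _; case: (_ && _).
have LL : (L <= bl) by apply: log_le => //; case/andP: Lbl.
(* The scaled count is at most [n * 2 ^ (bl + L)], which is below [2 ^ w]; the cell therefore equals
   it as a natural number. *)
rewrite modn_small => [->|]; last first.
  apply: (@leq_ltn_trans (n * k)); first by rewrite leq_mul2r sn orbT.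
  by rewrite -expnD ltn_exp2l //; lia.
rewrite muln_gt0 expn_gt0 andbT lt0n sum_nat_eq0.
apply/idP/existsP => [/forallPn[i]|[i ab]].
  by rewrite /= eqb0 negbK; exists i.
by apply/forallPn; exists i; rewrite ab.
Qed.

End Sumset.

(** * Sums *)

(* Variables: 0 the input, 4 the length of the convolution, 6 the stage minus
   two, 8 the complexity of the first summand minus one. *)
Definition clear_cmd : cmd :=
  For (Var 4 + Var 4)%exp (Store (Var base_var + Var 10)%exp (Lit 0)).

(** Marks the numbers of complexity [i.+1] and of complexity [s.+2 - i.+1]. Since [i <= s], an
    unknown number, stored as 0, enters neither array, nor does one just found in this stage. *)
Definition fill_cmd : cmd :=
  let t := (Var 10 + Lit 1)%exp in
  For (Var 0)
    (Seq (IfEq (Fetch t) (Var 8 + Lit 1) (Store (Var base_var + t) (Lit 1)))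
         (IfEq (Fetch t + (Var 8 + Lit 1)) (Var 6 + Lit 2)
            (Store (Var base_var + (Var 4 + t)) (Lit 1)))).

Definition harvest_cmd : cmd :=
  let t := (Var 10 + Lit 1)%exp in
  For (Var 0) (IfLt (Lit 0) (buf t) (IfEq (Fetch t) (Lit 0) (Store t (Var 6 + Lit 2)))).

Definition sum_step : cmd := Seq clear_cmd (Seq fill_cmd (Seq convolution harvest_cmd)).

Section SumStep.

Variables (w v e bl L N : nat).
Hypothesis (bl_gt0 : 0 < bl) (Lbl : 2 ^ L.-1 <= bl < 2 ^ L) (Nbl : N < 2 ^ bl).
Hypothesis (bv : 8 * bl <= v) (ve : 100 * v + 100 <= e) (ew : e.+2 <= w).

Notation D := (2 ^ e).
Notation n := (2 ^ bl.+1).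
Notation small := (small_env v e).

Lemma ev_Lit env M k : k < w -> ev w env M (Lit k) = k.
Proof.
by move=> kw; apply: modn_small; apply: ltn_2pow.
Qed.

Lemma ev_addr env M i : small env -> is_index base_var i -> index_bits v i <= e ->
  ev w env M (Var base_var + i)%exp = D + evN env i.
Proof.
move=> [HD Hi] ii li; have [|Ei lti] := ev_index M ii Hi (w := w); first by lia.
have ltD := ltn_exp2 lti li.
have D4 : 4 * D <= 2 ^ w by rewrite -[4]/(2 ^ 2) -expnD leq_exp2l.
by rewrite ev_Add Ei [ev _ _ _ (Var _)]HD modn_small //; lia.
Qed.

Lemma N_lt : N < 2 ^ v. Proof. by apply: ltn_exp2 Nbl _; lia. Qed.

Lemma v_le_w : 2 ^ v < 2 ^ w. Proof. by rewrite ltn_exp2l //; lia. Qed.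

Lemma N_D : n + n < D.
Proof. by rewrite addnn -mul2n -expnS ltn_exp2l //; lia. Qed.

Lemma sum_step_spec env M s i :
    small env -> env 0 = N -> env 1 = bl -> env 2 = L -> env 4 = n -> env 6 = s ->
    env 8 = i -> i <= s -> s < v -> (forall t, 0 < t <= N -> M t <= s.+2) ->
  let M' := sem w 9 env sum_step M in
  let A j := (0 < j <= N) && (M j == i.+1) in
  let B j := (0 < j <= N) && (M j + i.+1 == s.+2) in
  forall t, 0 < t <= N -> M' t =
    if (M t == 0) && [exists j : 'I_t.+1, A j && B (t - j)] then s.+2 else M t.
Proof.
move=> He E0 E1 E2 E4 E6 E8 les sv Mle M' A B.
have Nv := N_lt; have vw := v_le_w; have nD := N_D.
have n2v : n + n < 2 ^ v.
  by rewrite addnn -mul2n -expnS ltn_exp2l //; lia.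
have Nn : N < 2 ^ bl by [].
have nn : n = 2 ^ bl + 2 ^ bl by rewrite addnn -mul2n -expnS.
have sv2 : s.+2 < 2 ^ w.
  apply: leq_ltn_trans vw; apply: leq_trans (_ : v.+1 <= _); first by lia.
  exact: ltn_expl.
pose M1 := sem w 9 env clear_cmd M.
have HM1 a : M1 a = if D <= a < D + (n + n) then 0 else M a.
  rewrite /M1 /clear_cmd (@sem_For _ _ _ _ _ _ (n + n)); last 2 first.
  - rewrite (ev_small_index ew _ He); [by rewrite /= E4 | by [] | by clear -ve; move=> /=; lia].
  - by lia.
  rewrite (eq_iteri_lt (g := fun j M1 => upd M1 (D + j) 0)); last first.
    move=> j y jn; have s1 := small_loop (d := 9) isT He n2v jn.
    rewrite sem_Store (ev_addr _ s1); [|by []|by clear -ve; move=> /=; lia].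
    by rewrite ev_Lit //; lia.
  by rewrite (iteri_upd (val := fun _ _ => 0)).
pose M2 := sem w 9 env fill_cmd M1.
pose Q k M3 := [/\ forall a, a < D -> M3 a = M a,
   forall t, t < n -> M3 (D + t) = A t && (t <= k)
  & forall t, t < n -> M3 (D + (n + t)) = B t && (t <= k)].
have [Q1 Q2 Q3] : Q N M2.
  rewrite /M2 /fill_cmd (@sem_For _ _ _ _ _ _ N); last 2 first.
  - exact: E0.
  - by lia.
  apply: (iteri_ind (Q := Q)).
    split=> [a aD|t tn|t tn]; rewrite HM1.
    - by rewrite ifF //; lia.
    - by rewrite ifT /A; lia.
    - by rewrite ifT /B; lia.
  move=> k M3 kN [Q1 Q2 Q3].
  have s1 := small_loop (d := 9) isT He Nv kN; set env1 := upd _ _ _ in s1 *.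
  have Et M4 : ev w env1 M4 (Var 10 + Lit 1)%exp = k.+1.
    rewrite (ev_small_index ew _ s1); [exact: addn1 | by [] | by clear -ve; move=> /=; lia].
  have Ei M4 : ev w env1 M4 (Var 8 + Lit 1)%exp = i.+1.
    rewrite (ev_small_index ew _ s1); [by rewrite /= /env1 /upd /= E8 addn1 | by [] | by clear -ve; move=> /=; lia].
  have Es M4 : ev w env1 M4 (Var 6 + Lit 2)%exp = s.+2.
    rewrite (ev_small_index ew _ s1); [by rewrite /= /env1 /upd /= E6 addn2 | by [] | by clear -ve; move=> /=; lia].
  have E1l M4 : ev w env1 M4 (Lit 1) = 1 by apply: ev_Lit; lia.
  have Ea1 M4 : ev w env1 M4 (Var base_var + (Var 10 + Lit 1))%exp = D + k.+1.
    rewrite (ev_addr _ s1); [by rewrite /= /env1 /upd /= addn1 | by [] | by clear -ve; move=> /=; lia].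
  have Ea2 M4 : ev w env1 M4 (Var base_var + (Var 4 + (Var 10 + Lit 1)))%exp = D + (n + k.+1).
    rewrite (ev_addr _ s1); [by rewrite /= /env1 /upd /= E4 addn1 | by [] | by clear -ve; move=> /=; lia].
  have kD : k.+1 < D by lia.
  rewrite sem_Seq; set M4 := sem _ _ _ (IfEq (Fetch _) _ _) _.
  have EM4 : M4 = if M k.+1 == i.+1 then upd M3 (D + k.+1) 1 else M3.
    by rewrite /M4; cbn [sem]; rewrite ev_Fetch Et Ei Ea1 E1l Q1.
  set M5 := sem _ _ _ _ _.
  have Mk : M k.+1 <= s.+2 by apply: Mle; lia.
  have M4k : M4 k.+1 = M k.+1.
    by rewrite EM4; case: ifP => _; rewrite /upd ?ltn_eqF ?Q1 //; lia.
  have EM5 : M5 = if M k.+1 + i.+1 == s.+2 then upd M4 (D + (n + k.+1)) 1 else M4.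
    rewrite /M5; cbn [sem]; rewrite ev_Add ev_Fetch Et Ei Ea2 E1l Es M4k modn_small //.
    by apply: leq_ltn_trans (_ : _ <= w) (ltn_expl w (isT : 1 < 2)); lia.
  split=> [a aD|t tn|t tn].
  - rewrite EM5 EM4; do 2!case: ifP => _; rewrite /upd ?Q1 ?ltn_eqF //; try by lia.
  - have -> : M5 (D + t) = M4 (D + t).
      by rewrite EM5; case: ifP => // _; rewrite /upd ltn_eqF //; lia.
    rewrite EM4; case: ifP => Hk.
      rewrite /upd eqn_add2l; case: eqP => [->|neq].
        by rewrite /A Hk leqnn kN.
      rewrite Q2 //; congr (nat_of_bool (_ && _)).
      by rewrite (leq_eqVlt t k.+1) ltnS; move/eqP/negbTE: neq => ->.
    rewrite Q2 //; congr nat_of_bool; rewrite (leq_eqVlt t k.+1) ltnS.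
    by case: eqP => //= ->; rewrite /A Hk ltnn !andbF.
  - rewrite EM5; case: ifP => Hk.
      rewrite /upd !eqn_add2l; case: eqP => [->|neq].
        by rewrite /B Hk leqnn kN.
      have -> : M4 (D + (n + t)) = M3 (D + (n + t)).
        by rewrite EM4; case: ifP => // _; rewrite /upd gtn_eqF //; lia.
      rewrite Q3 //; congr (nat_of_bool (_ && _)).
      by rewrite (leq_eqVlt t k.+1) ltnS; move/eqP/negbTE: neq => ->.
    have -> : M4 (D + (n + t)) = M3 (D + (n + t)).
      by rewrite EM4; case: ifP => // _; rewrite /upd gtn_eqF //; lia.
    rewrite Q3 //; congr nat_of_bool; rewrite (leq_eqVlt t k.+1) ltnS.
    by case: eqP => //= ->; rewrite /B Hk ltnn !andbF.
have A0 t : 2 ^ bl <= t -> A t = false by rewrite /A => ?; apply/negbTE; lia.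
have B0 t : 2 ^ bl <= t -> B t = false by rewrite /B => ?; apply/negbTE; lia.
have AN t : A t && (t <= N) = A t by rewrite /A; case: (t <= N); rewrite ?andbF ?andbT //.
have BN t : B t && (t <= N) = B t by rewrite /B; case: (t <= N); rewrite ?andbF ?andbT //.
have [||C1 C2] := convolution_sumset bl_gt0 Lbl bv ve ew (M := M2) (a := A) (b := B) He E1 E2 _ _ A0 B0.
- by move=> t tn; rewrite Q2 // AN.
- by move=> t tn; rewrite Q3 // BN.
set M3 := sem w 9 env convolution M2 in C1 C2.
have EM' : M' = sem w 9 env harvest_cmd M3 by [].
pose H t := (M t == 0) && [exists j : 'I_t.+1, A j && B (t - j)].
pose Q' k M4 := (forall t, 0 < t <= N -> M4 t = if H t && (t <= k) then s.+2 else M t) /\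
  (forall t, t < n -> M4 (D + t) = M3 (D + t)).
suff [H1 _] : Q' N M' by move=> t tN; rewrite H1 // (_ : t <= N) ?andbT //; lia.
rewrite EM' /harvest_cmd (@sem_For _ _ _ _ _ _ N); last 2 first.
- exact: E0.
- by lia.
apply: (iteri_ind (Q := Q')).
  split=> // t tN; rewrite C2; last by lia.
  have -> : (t <= 0) = false by lia.
  by rewrite andbF Q1 //; lia.
move=> k M4 kN [Q4 Q5].
have s1 := small_loop (d := 9) isT He Nv kN; set env1 := upd _ _ _ in s1 *.
have Et M5 : ev w env1 M5 (Var 10 + Lit 1)%exp = k.+1.
  rewrite (ev_small_index ew _ s1); [exact: addn1 | by [] | by clear -ve; move=> /=; lia].
have Es M5 : ev w env1 M5 (Var 6 + Lit 2)%exp = s.+2.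
  rewrite (ev_small_index ew _ s1); [by rewrite /= /env1 /upd /= E6 addn2 | by [] | by clear -ve; move=> /=; lia].
have E0l M5 : ev w env1 M5 (Lit 0) = 0 by apply: ev_Lit; lia.
have Ea M5 : ev w env1 M5 (Var base_var + (Var 10 + Lit 1))%exp = D + k.+1.
  rewrite (ev_addr _ s1); [by rewrite /= /env1 /upd /= addn1 | by [] | by clear -ve; move=> /=; lia].
set M5 := sem _ _ _ _ _.
have EM5 : M5 = if H k.+1 then upd M4 k.+1 s.+2 else M4.
  rewrite /M5; cbn [sem]; rewrite !ev_Fetch !Ea !Et !Es !E0l Q5; last by lia.
  rewrite C1; last by lia.
  rewrite Q4; last by lia.
  rewrite ltnn andbF /H andbC; case: ifP => //=.
split=> [t tN|t tn]; last first.
  by rewrite EM5; case: ifP => _; rewrite /upd ?Q5 // gtn_eqF ?Q5 //; lia.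
rewrite EM5 (leq_eqVlt t) ltnS; case: ifP => Hk.
  rewrite /upd; case: eqP => [->|_]; first by rewrite Hk.
  by rewrite Q4.
by rewrite Q4 //; case: eqP => //= ->; rewrite Hk.
Qed.

End SumStep.

(** * Products and stages *)

Lemma value_gt0 x : 0 < value x.
Proof. by elim: x => //= a IHa b IHb; [rewrite addn_gt0 IHa|rewrite muln_gt0 IHa]. Qed.

Lemma ones_gt0 x : 0 < ones x.
Proof. by elim: x => //= a IHa b IHb; rewrite addn_gt0 IHa. Qed.

(** Horner's rule in base two: doubling costs two ones, adding a bit at most one. Hence [3 * bl]
    stages suffice. *)
Lemma expr_exists k n : 0 < n < 2 ^ k -> exists2 x, value x = n & ones x <= 3 * k.
Proof.
elim: k n => [|k IH] n; first by rewrite expn0; lia.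
rewrite expnS => /andP[n0 nk]; have [n1|n1] := leqP n 1.
  by exists One => /=; lia.
have [|x vx ox] := IH (n %/ 2); first by lia.
have [n2|n2] := eqVneq (n %% 2) 0.
  by exists (Times (Plus One One) x) => /=; lia.
by exists (Plus (Times (Plus One One) x) One) => /=; lia.
Qed.

(** * Growth of the table by one complexity *)

Section Known.

Variable N : nat.

(** No complexity is zero, so a zero cell can stand for a complexity greater than [m]. *)
Definition known m (M : nat -> nat) := forall n, 0 < n <= N ->
  (M n = 0 /\ forall x, value x = n -> m < ones x) \/ (is_complexity n (M n) /\ M n <= m).

(** The invariant inside stage [m], which reads and writes the same table: anything new is an entry
    [m], backed by an expression and put where there was zero. *)
Definition extends m (M0 M : nat -> nat) := forall n, 0 < n <= N ->
  M n = M0 n \/ [/\ M0 n = 0, M n = m & exists2 x, value x = n & ones x = m].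

Lemma known_le m M n : known m M -> 0 < n <= N -> M n <= m.
Proof. by move=> H /H[[->]|[]]. Qed.

Lemma known_expr m M n : known m M -> 0 < n <= N -> 0 < M n ->
  exists2 x, value x = n & ones x = M n.
Proof. by move=> H /H[[-> //]|[[]]]. Qed.

(** An exchange argument: if the whole expression cannot be shortened, neither can its operand [x],
    so the table holds [ones x]. *)
Lemma known_min m M x y : known m M -> 0 < value x <= N ->
    ones x <= m -> ones x + ones y = m.+1 ->
    (forall x', value x' = value x -> m < ones x' + ones y) ->
  M (value x) = ones x.
Proof.
move=> H vN om oz min; have [[_ /(_ x erefl)]|[[[x' vx' ox'] minx] _]] := H _ vN; first by lia.
by have := minx x erefl; have := min x' vx'; lia.
Qed.

Lemma extends_eq m M0 M n : extends m M0 M -> 0 < n <= N -> 0 < M0 n -> M n = M0 n.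
Proof. by move=> H /H[->|[->]]. Qed.

Lemma extends_old m M0 M n : extends m M0 M -> 0 < n <= N -> M n != m -> M n = M0 n.
Proof. by move=> H /H[->|[_ ->]] //; rewrite eqxx. Qed.

(** Soundness comes from [extends]. For completeness, split an expression with [m.+1] ones at its
    outermost operation: when it is minimal both operands are, so the table [M0] knows them and the
    hypotheses fill the cell. *)
Lemma known_next m M0 M : 0 < m -> known m M0 -> extends m.+1 M0 M ->
    (forall a b, 0 < a -> 0 < b -> a + b <= N -> 0 < M0 a -> 0 < M0 b ->
       M0 a + M0 b = m.+1 -> 0 < M (a + b)) ->
    (forall a b, 0 < a -> 0 < b -> a * b <= N -> 0 < M0 a -> 0 < M0 b ->
       M0 a + M0 b = m.+1 -> 0 < M (a * b)) ->
  known m.+1 M.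
Proof.
move=> m0 K E Hadd Hmul n nN.
have [[Z0 min]|[cn le]] := K n nN; last first.
  have Mpos : 0 < M0 n by case: cn => [[x vx <-] _]; apply: ones_gt0.
  by right; rewrite (extends_eq E nN Mpos); split=> //; apply: leqW.
have [EM|[_ EM [x vx ox]]] := E n nN; last first.
  by right; rewrite EM; split=> //; split; [exists x | move=> y /min].
left; rewrite EM Z0; split=> // x vx.
have := min x vx; rewrite leq_eqVlt => /predU1P[ox|//].
have Mn0 : M n = 0 by rewrite EM.
case: x vx ox => [|a b|a b] /= vx ox; first by lia.
  have a0 := ones_gt0 a; have b0 := ones_gt0 b; have va0 := value_gt0 a; have vb0 := value_gt0 b.
  have Ea : M0 (value a) = ones a.
    apply: (known_min (x := a) (y := b) K); try by lia.
    by move=> x' vx'; apply: (min (Plus x' b)); rewrite /= vx'.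
  have Eb : M0 (value b) = ones b.
    apply: (known_min (x := b) (y := a) K); try by lia.
    by move=> x' vx'; rewrite addnC; apply: (min (Plus a x')); rewrite /= vx'.
  by have := Hadd (value a) (value b); rewrite Ea Eb vx Mn0; lia.
have a0 := ones_gt0 a; have b0 := ones_gt0 b; have va0 := value_gt0 a; have vb0 := value_gt0 b.
have van : value a <= n by rewrite -vx leq_pmulr.
have vbn : value b <= n by rewrite -vx leq_pmull.
have Ea : M0 (value a) = ones a.
  apply: (known_min (x := a) (y := b) K); try by lia.
  by move=> x' vx'; apply: (min (Times x' b)); rewrite /= vx'.
have Eb : M0 (value b) = ones b.
  apply: (known_min (x := b) (y := a) K); try by lia.
  by move=> x' vx'; rewrite addnC; apply: (min (Times a x')); rewrite /= vx'.
by have := Hmul (value a) (value b); rewrite Ea Eb vx Mn0; lia.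
Qed.

End Known.

(* Variables: 8 and 10 the factors minus one. *)
Definition product_step : cmd :=
  let x := (Var 8 + Lit 1)%exp in let y := (Var 10 + Lit 1)%exp in
  For (Var 0) (For (Var 0 %/ x)%exp
    (IfLt (Lit 0) (Fetch x) (IfLt (Lit 0) (Fetch y)
      (IfEq (Fetch x + Fetch y)%exp (Var 6 + Lit 2)%exp
        (IfEq (Fetch (x * y)%exp) (Lit 0) (Store (x * y)%exp (Var 6 + Lit 2)%exp)))))).

Definition stage : cmd := Seq (For (Var 6 + Lit 1)%exp sum_step) product_step.

Section Stage.

Variables (w v e bl L N : nat).
Hypothesis (bl_gt0 : 0 < bl) (Lbl : 2 ^ L.-1 <= bl < 2 ^ L) (Nbl : N < 2 ^ bl).
Hypothesis (bv : 8 * bl <= v) (ve : 100 * v + 100 <= e) (ew : e.+2 <= w).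

Notation D := (2 ^ e).
Notation n := (2 ^ bl.+1).
Notation small := (small_env v e).

Lemma product_step_spec env M0 M1 s :
    small env -> env 0 = N -> env 6 = s -> s.+2 < v ->
    known N s.+1 M0 -> extends N s.+2 M0 M1 ->
  let M' := sem w 7 env product_step M1 in
  [/\ extends N s.+2 M0 M',
      forall t, 0 < t <= N -> 0 < M1 t -> 0 < M' t
    & forall a b, 0 < a -> 0 < b -> a * b <= N -> 0 < M0 a -> 0 < M0 b ->
       M0 a + M0 b = s.+2 -> 0 < M' (a * b)].
Proof.
move=> He E0 E6 sv K E1 M'.
have Nv : N < 2 ^ v by apply: ltn_exp2 Nbl _; lia.
have vw : 2 ^ v < 2 ^ w by rewrite ltn_exp2l //; lia.
pose Q k M := [/\ extends N s.+2 M0 M,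
      forall t, 0 < t <= N -> 0 < M1 t -> 0 < M t
    & forall a b, 0 < a <= k -> 0 < b -> a * b <= N -> 0 < M0 a -> 0 < M0 b ->
       M0 a + M0 b = s.+2 -> 0 < M (a * b)].
suff [H1 H2 H3] : Q N M'.
  split=> // a b a0 b0 ab; apply: H3 => //; rewrite a0 /=.
  by apply: leq_trans ab; rewrite leq_pmulr.
rewrite /M' /product_step (@sem_For _ _ _ _ _ _ N); last 2 first.
- exact: E0.
- by lia.
apply: (iteri_ind (Q := Q)); first by split=> // a b; lia.
move=> k M kN [Q1 Q2 Q3].
have s1 := small_loop (d := 7) isT He Nv kN; set env1 := upd _ _ _ in s1 *.
have kdN : N %/ k.+1 < 2 ^ v by apply: leq_ltn_trans (leq_div _ _) Nv.
rewrite (@sem_For _ _ _ _ _ _ (N %/ k.+1)); last 2 first.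
- rewrite (ev_small_index ew _ s1); [by rewrite /= /env1 /upd /= E0 addn1 | by [] | by clear -ve; move=> /=; lia].
- by apply: ltn_trans kdN vw.
pose Q' j M := [/\ extends N s.+2 M0 M,
      forall t, 0 < t <= N -> 0 < M1 t -> 0 < M t,
      forall a b, 0 < a <= k -> 0 < b -> a * b <= N -> 0 < M0 a -> 0 < M0 b ->
       M0 a + M0 b = s.+2 -> 0 < M (a * b)
    & forall b, 0 < b <= j -> 0 < M0 k.+1 -> 0 < M0 b ->
       M0 k.+1 + M0 b = s.+2 -> 0 < M (k.+1 * b)].
suff [H1 H2 H3 H4] : Q' (N %/ k.+1)
    (iteri (N %/ k.+1) (fun j => sem w 11 (upd (upd env1 9 (N %/ k.+1)) 10 j)
      (IfLt (Lit 0) (Fetch (Var 8 + Lit 1)) (IfLt (Lit 0) (Fetch (Var 10 + Lit 1))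
      (IfEq (Fetch (Var 8 + Lit 1) + Fetch (Var 10 + Lit 1)) (Var 6 + Lit 2)
        (IfEq (Fetch ((Var 8 + Lit 1) * (Var 10 + Lit 1))) (Lit 0)
           (Store ((Var 8 + Lit 1) * (Var 10 + Lit 1)) (Var 6 + Lit 2))))))) M).
  split=> // a b /andP[a0]; rewrite leq_eqVlt => /predU1P[->|ak] b0 ab.
    by apply: H4; rewrite b0 leq_divRL // mulnC.
  by apply: H3 => //; rewrite a0.
apply: (iteri_ind (Q := Q')); first by split=> // b; lia.
move=> j M2 jN [P1 P2 P3 P4].
have s2 := small_loop (d := 9) isT s1 kdN jN; set env2 := upd (upd env1 9 _) _ _ in s2 *.
have kjN : k.+1 * j.+1 <= N by rewrite mulnC -leq_divRL.
have jN' : j.+1 <= N by apply: leq_trans kjN; rewrite leq_pmull.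
have Ex M3 : ev w env2 M3 (Var 8 + Lit 1)%exp = k.+1.
  rewrite (ev_small_index ew _ s2); [exact: addn1 | by [] | by clear -ve; move=> /=; lia].
have Ey M3 : ev w env2 M3 (Var 10 + Lit 1)%exp = j.+1.
  rewrite (ev_small_index ew _ s2); [exact: addn1 | by [] | by clear -ve; move=> /=; lia].
have Exy M3 : ev w env2 M3 ((Var 8 + Lit 1) * (Var 10 + Lit 1))%exp = k.+1 * j.+1.
  by rewrite ev_Mul Ex Ey modn_small //; lia.
have Es M3 : ev w env2 M3 (Var 6 + Lit 2)%exp = s.+2.
  rewrite (ev_small_index ew _ s2); [by rewrite /= /env2 /upd /= /env1 /upd /= E6 addn2 | by [] | by clear -ve; move=> /=; lia].
have E0l M3 : ev w env2 M3 (Lit 0) = 0 by apply: mod0n.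
have kN' : 0 < k.+1 <= N by lia.
have jN2 : 0 < j.+1 <= N by lia.
have kjN2 : 0 < k.+1 * j.+1 <= N by rewrite muln_gt0.
have le2 t : 0 < t <= N -> M2 t <= s.+2.
  by move=> tN; case: (P1 t tN) => [->|[_ -> _]] //; apply: leqW; apply: known_le K tN.
set M3 := sem _ _ _ _ _.
pose cond := [&& 0 < M2 k.+1, 0 < M2 j.+1, M2 k.+1 + M2 j.+1 == s.+2 & M2 (k.+1 * j.+1) == 0].
have EM3 : M3 = if cond then upd M2 (k.+1 * j.+1) s.+2 else M2.
  rewrite /M3 /cond; cbn [sem]; rewrite ev_Add !ev_Fetch !Ex !Ey !Exy !Es !E0l.
  rewrite modn_small; last by have := le2 _ kN'; have := le2 _ jN2; move=> ? ?; apply: ltn_2pow; lia.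
  by case: (0 < M2 k.+1); case: (0 < M2 j.+1); case: (_ == s.+2); case: (_ == 0).
have mono t : 0 < t <= N -> 0 < M2 t -> 0 < M3 t.
  by move=> tN t0; rewrite EM3; case: ifP => // _; rewrite /upd; case: ifP.
split.
- rewrite EM3 /cond; case: ifP => // /and4P[a0 b0 /eqP ab /eqP c0] t tN.
  rewrite /upd; case: eqP => [Et|_]; last exact: P1.
  right; subst t.
  (* Two positive entries with sum [s.+2] are both smaller than [s.+2], so neither was written in
     this stage. *)
  have Ea : M2 k.+1 = M0 k.+1 by apply: (extends_old P1 kN'); apply/eqP; lia.
  have Eb : M2 j.+1 = M0 j.+1 by apply: (extends_old P1 jN2); apply/eqP; lia.
  have [|x vx ox] := known_expr K kN'; first by lia.
  have [|y vy oy] := known_expr K jN2; first by lia.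
  split=> //; last by exists (Times x y) => /=; rewrite ?vx ?vy //; lia.
  by case: (P1 _ tN) => [<-|[]].
- by move=> t tN /(P2 t tN); apply: mono.
- move=> a b ak b0 abN a1 b1 ab; apply: mono; last exact: P3.
  by rewrite abN muln_gt0 b0; case/andP: ak => ->.
- move=> b /andP[b0]; rewrite leq_eqVlt => /predU1P[->|bj] a1 b1 ab; last first.
    have bj' : 0 < b <= j by rewrite b0.
    apply: mono; last exact: P4.
    rewrite muln_gt0 b0 /=; apply: leq_trans kjN; rewrite leq_mul2l; lia.
  have [z|z] := posnP (M2 (k.+1 * j.+1)); last exact: mono.
  rewrite EM3 /cond (extends_eq P1 kN' a1) (extends_eq P1 jN2 b1) a1 b1 ab z !eqxx /=.
  by rewrite /upd eqxx.
Qed.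

Lemma stage_spec env M0 s :
    small env -> env 0 = N -> env 1 = bl -> env 2 = L -> env 4 = n -> env 6 = s ->
    s.+2 < v -> known N s.+1 M0 ->
  known N s.+2 (sem w 7 env stage M0).
Proof.
move=> He E0 E1 E2 E4 E6 sv K.
have vw : 2 ^ v < 2 ^ w by rewrite ltn_exp2l //; lia.
rewrite /stage sem_Seq (@sem_For _ _ _ _ _ _ s.+1); last 2 first.
- rewrite (ev_small_index ew _ He); [by rewrite /= E6 addn1 | by [] | by clear -ve; move=> /=; lia].
- by apply: ltn_2pow; lia.
(* The splits whose first summand has complexity at most [k] have been treated. *)
pose Q k M := extends N s.+2 M0 M /\
   forall a b, 0 < a -> 0 < b -> a + b <= N -> 0 < M0 a <= k -> 0 < M0 b ->
       M0 a + M0 b = s.+2 -> 0 < M (a + b).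
set M1 := iteri _ _ _.
have [Q1 Q2] : Q s.+1 M1.
  apply: (iteri_ind (Q := Q)); first by split=> [t tN|a b]; [left | lia].
  move=> i M is1 [Q1 Q2].
  have s1 : small (upd (upd env 7 s.+1) 8 i).
    by apply: small_upd_lin => //; [lia|]; apply: small_upd_lin => //; lia.
  set env1 := upd _ _ _ in s1 *.
  have leM t : 0 < t <= N -> M t <= s.+2.
    by move=> tN; case: (Q1 t tN) => [->|[_ -> _]] //; apply: leqW; apply: known_le K tN.
  have is' : i <= s by lia.
  have sv' : s < v by lia.
  have := sum_step_spec bl_gt0 Lbl Nbl bv ve ew (M := M) (s := s) (i := i)
    s1 E0 E1 E2 E4 E6 erefl is' sv' leM.
  cbv zeta; set M' := sem _ _ _ _ _ => HM'.
  split.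
    move=> t tN; rewrite HM' //; case: ifP => [|_]; last exact: Q1.
    case/andP=> /eqP Mt /existsP[j /andP[/andP[jN /eqP Mj] /andP[tjN /eqP Mtj]]].
    right.
    have Ej : M j = M0 j by apply: (extends_old Q1 jN); apply/eqP; lia.
    have Etj : M (t - j) = M0 (t - j) by apply: (extends_old Q1 tjN); apply/eqP; lia.
    have [|x vx ox] := known_expr K jN; first by lia.
    have [|y vy oy] := known_expr K tjN; first by lia.
    split=> //; last by exists (Plus x y) => /=; lia.
    by case: (Q1 t tN) => [<-|[]].
  move=> a b a0 b0 abN /andP[Ma0 Mai] Mb0 Mab.
  have abN' : 0 < a + b <= N by lia.
  rewrite HM' //; case: ifP => // /negbT; rewrite negb_and => Hneg.
  have [lei|gti] := leqP (M0 a) i; first by apply: Q2 => //; rewrite Ma0.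
  have [z|//] := posnP (M (a + b)).
  move: Hneg; rewrite z eqxx /= => /existsPn.
  have ltab : a < (a + b).+1 by lia.
  move=> /(_ (Ordinal ltab)) /=; rewrite addKn.
  have aN : 0 < a <= N by lia.
  have bN : 0 < b <= N by lia.
  have Mai' : M0 a = i.+1 by lia.
  by rewrite aN bN (extends_eq Q1 aN Ma0) (extends_eq Q1 bN Mb0) Mai' eqxx -Mab Mai' addnC eqxx.
have [P1 P2 P3] := product_step_spec He E0 E6 sv K Q1.
apply: (known_next (M0 := M0)) => // a b a0 b0 ab Ma Mb Mab.
have := known_le K; move=> Kle.
apply: P2; first by lia.
by apply: Q2 => //; rewrite Ma /=; lia.
Qed.

End Stage.

(** * The program *)

Lemma run_Seq w d env c1 c2 M : run w d env (Seq c1 c2) M =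
  add_time (cost w d env c1 M) (run w d env c2 (sem w d env c1 M)).
Proof. by []. Qed.

(* Cell 0 counts the bits; the results live in the cells from 1 on. *)
Definition bit_length_cmd (d x : nat) : cmd :=
  Seq (Store (Lit 0) (Lit 0))
    (For (Var x) (IfLt (pow2 (Fetch (Lit 0))) (Var d.+1 + Lit 2)
       (Store (Lit 0) (Fetch (Lit 0) + Lit 1)))).

Definition stages_cmd : cmd := Seq (Store (Lit 1) (Lit 1)) (For (Lit 3 * Var 1)%exp stage).

(** All variables except the base address fit in [8 * bl] bits, and
    [100 * (8 * bl) + 100 <= 1000 * bl]; this fixes the base at [2 ^ (1000 * bl)], above all indices
    and all result cells. A word of [1010 * bl] bits also accommodates the two extra bits needed for
    the second array. *)
Definition main_cmd : cmd :=
  Seq (bit_length_cmd 1 0) (Let (Fetch (Lit 0))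
  (Seq (bit_length_cmd 2 1) (Let (Fetch (Lit 0))
  (Let (pow2 (Lit 1000 * Var 1)) (Let (pow2 (Var 1 + Lit 1)) stages_cmd))))).

Lemma bit_lengthP N k : 2 ^ k.-1 <= N < 2 ^ k -> 0 < N -> bit_length N = k.
Proof.
case: k => [|k] /= H N0; first by move: H; rewrite expn0; lia.
by rewrite /bit_length (trunc_log_eq _ H).
Qed.

Lemma bit_length_bounds N : 0 < N -> 2 ^ (bit_length N).-1 <= N < 2 ^ bit_length N.
Proof. exact: trunc_log_bounds. Qed.

Lemma bit_length_cmd_spec w d x env M :
    x < d -> 0 < env x -> 2 * env x + 4 < 2 ^ w ->
  let M' := sem w d env (bit_length_cmd d x) M in
  M' 0 = bit_length (env x) /\ forall a, 0 < a -> M' a = M a.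
Proof.
move=> xd x0 xw; rewrite /bit_length_cmd sem_Seq (@sem_For _ _ _ _ _ _ (env x)) //; last by lia.
have w2 : 2 %% 2 ^ w = 2 by rewrite modn_small //; lia.
have w1 : 1 %% 2 ^ w = 1 by rewrite modn_small //; lia.
(* Cell 0 holds the bit length of [i], starting with 0 for [i = 0]. The test [2 ^ c < i + 2] asks
   whether [i + 1] needs another bit; a loop of linear length is affordable here. *)
pose Q i M2 := (i < 2 ^ M2 0 <= (2 * i).+1) /\ forall a, 0 < a -> M2 a = M a.
set M' := iteri _ _ _.
have [H1 H2] : Q (env x) M'.
  apply: (iteri_ind (Q := Q)).
    by rewrite /Q sem_Store /= mod0n; split=> // -[].
  move=> i M1 ix [H1 H2]; set env1 := upd _ _ _.
  have M1w : M1 0 < w by rewrite -(ltn_exp2l _ _ (isT : 1 < 2)); lia.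
  have EM : sem w d.+2 env1 (IfLt (pow2 (Fetch (Lit 0))) (Var d.+1 + Lit 2)
       (Store (Lit 0) (Fetch (Lit 0) + Lit 1))) M1 =
      if 2 ^ M1 0 < i.+2 then upd M1 0 (M1 0).+1 else M1.
    rewrite /= mod0n w1 w2 mul1n (modn_small (_ : 2 ^ M1 0 < 2 ^ w)) ?ltn_exp2l //.
    rewrite {1}/env1 /upd eqxx addn2 (modn_small (_ : i.+2 < _)); last by lia.
    rewrite addn1 (modn_small (_ : (M1 0).+1 < _)) //.
    by apply: leq_ltn_trans M1w (ltn_expl w _).
  rewrite EM; split=> [|a a0]; last first.
    by case: ifP => _; rewrite /upd ?gtn_eqF // H2.
  case: ifP => Hlt; last by lia.
  by rewrite /upd eqxx expnS; lia.
split=> //; apply: esym; apply: bit_lengthP => //.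
case: (M' 0) H1 => [|k] /=; first by rewrite expn0; lia.
by rewrite expnS; lia.
Qed.

Lemma known_init N M : (forall a, 0 < a -> M a = 0) -> known N 1 (upd M 1 1).
Proof.
move=> M0 k kN; rewrite /upd; case: eqP => [->|k1].
  by right; split=> //; split=> [|x _]; [exists One | apply: ones_gt0].
left; rewrite M0; last by lia.
split=> // x vx; rewrite ltn_neqAle ones_gt0 andbT; apply/eqP => o1.
case: x vx o1 => [|a b|a b] /=; first by lia.
  by have := ones_gt0 a; have := ones_gt0 b; lia.
by have := ones_gt0 a; have := ones_gt0 b; lia.
Qed.

Section Main.

Variables (w N : nat).
Hypothesis N_gt0 : 0 < N.
Notation bl := (bit_length N).
Notation L := (bit_length bl).
Hypothesis blw : 1010 * bl <= w.

Let bl_gt0 : 0 < bl. Proof. by []. Qed.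

Definition main_env : nat -> nat :=
  upd (upd (upd (upd (upd (fun=> 0) 0 N) 1 bl) 2 L) 3 (2 ^ (1000 * bl))) 4 (2 ^ bl.+1).

Lemma main_env_small : small_env (8 * bl) (1000 * bl) main_env.
Proof.
split=> // i /negbTE iD; rewrite /main_env /upd iD.
have Lb : L <= bl by apply: log_le => //; case/andP: (bit_length_bounds bl_gt0).
have lin k : k <= bl -> k < 2 ^ (8 * bl).
  move=> kb; apply: ltn_trans (ltn_expl k (isT : 1 < 2)) _.
  by rewrite ltn_exp2l //; move: bl_gt0; lia.
case: eqP => [_|_]; first by rewrite ltn_exp2l //; move: bl_gt0; lia.
case: eqP => [_|_]; first exact: lin.
case: eqP => [_|_]; first exact: lin.
case: eqP => [_|_]; last by rewrite expn_gt0.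
by apply: ltn_exp2 (_ : N < 2 ^ bl) _; [case/andP: (bit_length_bounds N_gt0) | lia].
Qed.

Lemma pow_lt_w k : k <= 1000 * bl -> 4 * 2 ^ k < 2 ^ w.
Proof. by move=> kb; rewrite -[4]/(2 ^ 2) -expnD ltn_exp2l //; move: bl_gt0; lia. Qed.

Lemma main_run : exists M,
  [/\ run w 1 (upd (fun=> 0) 0 N) main_cmd (fun=> 0) =
        add_time (cost w 1 (upd (fun=> 0) 0 N) (bit_length_cmd 1 0) (fun=> 0) +
                  cost w 2 (upd (upd (fun=> 0) 0 N) 1 bl) (bit_length_cmd 2 1)
                    (sem w 1 (upd (fun=> 0) 0 N) (bit_length_cmd 1 0) (fun=> 0)) + 14)
                 (run w 5 main_env stages_cmd M)
    & forall a, 0 < a -> M a = 0].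
Proof.
have Nb : N < 2 ^ bl by case/andP: (bit_length_bounds N_gt0).
have Nw : 2 * N + 4 < 2 ^ w.
  have := @pow_lt_w bl; have := @pow_lt_w 3; rewrite -[2 ^ 3]/8; move: bl_gt0; lia.
have bb : bl < 2 ^ bl by apply: ltn_expl.
have bw : 2 * bl + 4 < 2 ^ w.
  have := @pow_lt_w bl; have := @pow_lt_w 3; rewrite -[2 ^ 3]/8; move: bl_gt0; lia.
have [H1 H2] := @bit_length_cmd_spec w 1 0 (upd (fun=> 0) 0 N) (fun=> 0) isT N_gt0 Nw.
rewrite /main_cmd; set M1 := sem _ _ _ _ _ in H1 H2 *.
have [H3 H4] := @bit_length_cmd_spec w 2 1 (upd (upd (fun=> 0) 0 N) 1 bl) M1 isT bl_gt0 bw.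
set M2 := sem _ _ _ _ M1 in H3 H4.
have ew0 : 0 %% 2 ^ w = 0 by apply: mod0n.
exists M2; split; last by move=> a a0; rewrite H4 // H2.
rewrite run_Seq -/M1 (@run_Let _ _ _ _ _ _ bl); last by rewrite /= ew0 H1.
rewrite run_Seq -/M2 (@run_Let _ _ _ _ _ _ L); last by rewrite /= ew0 H3.
set env2 := upd (upd (upd _ 0 N) 1 _) 2 _.
have wb : 1000 * bl < w by move: bl_gt0; lia.
have wb1 : bl.+1 < w by move: bl_gt0; lia.
have lin k : k < w -> k < 2 ^ w by apply: ltn_2pow.
rewrite (@run_Let _ _ _ _ _ _ (2 ^ (1000 * bl))); last first.
  apply: (ev_shl1 _ wb); rewrite ev_Mul [ev _ _ _ (Lit _)]/=.
  rewrite (modn_small (_ : 1000 < _)); last by apply: lin; move: bl_gt0; lia.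
  by apply: modn_small; apply: lin; apply: wb.
rewrite (@run_Let _ _ _ _ _ _ (2 ^ bl.+1)); last first.
  apply: ev_shl1; last by move: bl_gt0; lia.
  rewrite ev_Add [ev _ _ _ (Lit _)]/=.
  rewrite (modn_small (_ : 1 < _)); last by apply: lin; move: bl_gt0; lia.
  by rewrite addn1; apply: modn_small; apply: lin; apply: wb1.
by rewrite !add_timeD; congr (add_time _ _) => /=; lia.
Qed.

Lemma main_spec n : 0 < n <= N ->
  is_complexity n (sem w 1 (upd (fun=> 0) 0 N) main_cmd (fun=> 0) n).
Proof.
move=> nN; have [M [HM M0]] := main_run.
have -> : sem w 1 (upd (fun=> 0) 0 N) main_cmd (fun=> 0) = sem w 5 main_env stages_cmd M.
  exact: (congr1 fst HM).
have Nb : N < 2 ^ bl by case/andP: (bit_length_bounds N_gt0).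
have Lb := bit_length_bounds bl_gt0.
have lin k : k < w -> k < 2 ^ w by apply: ltn_2pow.
have ve : 100 * (8 * bl) + 100 <= 1000 * bl by move: bl_gt0; lia.
have ew : (1000 * bl).+2 <= w by move: bl_gt0; lia.
have He := main_env_small.
have wb3 : 3 * bl < w by move: bl_gt0; lia.
have w1 : 1 %% 2 ^ w = 1 by apply: modn_small; apply: lin; move: bl_gt0; lia.
rewrite /stages_cmd sem_Seq sem_Store [ev _ _ _ (Lit 1)]w1.
rewrite (@sem_For _ _ _ _ _ _ (3 * bl)); last 2 first.
- rewrite ev_Mul [ev _ _ _ (Lit _)]/= (modn_small (_ : 3 < _)); last by apply: lin; move: bl_gt0; lia.
  by apply: modn_small; apply: lin; apply: wb3.
- by apply: lin; apply: wb3.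
pose Q k M := known N k.+1 M.
set M' := iteri _ _ _.
have HK : Q (3 * bl) M'.
  apply: (iteri_ind (Q := Q)).
    exact: known_init.
  move=> s M1 sb K1; have sv : s.+2 < 8 * bl by move: bl_gt0; lia.
  have s5 : small_env (8 * bl) (1000 * bl) (upd (upd main_env 5 (3 * bl)) 6 s).
    apply: small_upd_lin; [by [] | by lia | ].
    by apply: small_upd_lin; [by [] | by move: bl_gt0; lia | ].
  exact: (stage_spec bl_gt0 Lb Nb (leqnn _) ve ew s5 erefl erefl erefl erefl erefl sv K1).
have [[z min]|[H _]] := HK n nN; last exact: H.
(* A cell that is still zero would have complexity above [3 * bl + 1], against the bound of three
   ones per bit. *)
have [|x vx ox] := @expr_exists bl n; first by lia.
by have := min x vx; lia.
Qed.

End Main.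

(** * Running time *)

(** Independent of the memory, so the time of an innermost loop body is bounded by plain
    evaluation. *)
Fixpoint static_cost (c : cmd) : nat :=
  match c with
  | Store a x => exp_size a + exp_size x + 1
  | Seq c1 c2 => static_cost c1 + static_cost c2
  | Let x c => exp_size x + static_cost c
  | IfEq a b c | IfLt a b c => exp_size a + exp_size b + static_cost c + 2
  | For _ _ => 0
  end.

Fixpoint loop_free (c : cmd) : bool :=
  match c with
  | Store _ _ => true
  | Seq c1 c2 => loop_free c1 && loop_free c2
  | Let _ c | IfEq _ _ c | IfLt _ _ c => loop_free c
  | For _ _ => false
  end.

Lemma cost_static w d env c M : loop_free c -> cost w d env c M <= static_cost c.
Proof.
elim: c d env M => //= [a x|c1 IH1 c2 IH2|x c IH|a b c IH|a b c IH] d env M.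
- by lia.
- by case/andP=> l1 l2; apply: leq_add; [apply: IH1|apply: IH2].
- by move=> lc; rewrite leq_add2l IH.
- by move=> lc; case: ifP => _; have := IH d env M lc; lia.
- by move=> lc; case: ifP => _; have := IH d env M lc; lia.
Qed.

Lemma cost_Seq w d env c1 c2 M :
  cost w d env (Seq c1 c2) M = cost w d env c1 M + cost w d env c2 (sem w d env c1 M).
Proof. by []. Qed.

(** The 5 consists of two instructions to reduce the bound, one to clear the counter and two to
    leave the loop. *)
Lemma cost_For_sum w d env x c M n (b : nat -> nat) :
    ev w env M x = n -> n < 2 ^ w ->
    (forall i M', i < n -> cost w d.+2 (upd (upd env d n) d.+1 i) c M' <= b i) ->
  cost w d env (For x c) M <= exp_size x + 5 + \sum_(i < n) (b i + 4).
Proof.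
move=> xn nw H; cbn [cost]; rewrite (ev_bound xn nw).
set s1 := \sum_(_ < _) _; set s2 := \sum_(_ < _) _.
have le12 : s1 <= s2 by apply: leq_sum => i _; rewrite leq_add2r H.
by rewrite [exp_size (bound x)]/=; lia.
Qed.

Lemma cost_For w d env x c M n b :
    ev w env M x = n -> n < 2 ^ w ->
    (forall i M', i < n -> cost w d.+2 (upd (upd env d n) d.+1 i) c M' <= b) ->
  cost w d env (For x c) M <= exp_size x + 5 + n * (b + 4).
Proof.
move=> xn nw H; have := @cost_For_sum w d env x c M n (fun=> b) xn nw H.
by rewrite sum_nat_const card_ord.
Qed.

Lemma pass_cost w d len g env M : env len < 2 ^ w ->
  cost w d env (pass d len g) M <= (env len).+1 * (exp_size g + 24).
Proof.
move=> lw; rewrite /pass cost_Seq.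
set M1 := sem _ _ _ _ _.
have H1 : cost w d env (For (Var len) (Store (Var base_var + Var base_var + Var d.+1)%exp g)) M <=
    1 + 5 + env len * (exp_size g + 6 + 4).
  by apply: cost_For => // i M' _ /=; lia.
have H2 : cost w d env (For (Var len) (Store (Var base_var + Var d.+1)%exp
    (Fetch (Var base_var + Var base_var + Var d.+1)%exp))) M1 <= 1 + 5 + env len * (10 + 4).
  by apply: cost_For => // i M' _ /=; lia.
by apply: leq_trans (leq_add H1 H2) _; nia.
Qed.

(** * Cost of a convolution *)

Section ConvolutionCost.

Variables (w v e bl L : nat).
Hypothesis (bl_gt0 : 0 < bl) (Lbl : 2 ^ L.-1 <= bl < 2 ^ L).
Hypothesis (bv : 8 * bl <= v) (ve : 100 * v + 100 <= e) (ew : e.+2 <= w).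

Notation small := (small_env v e).
Notation row_log := (row_log bl).
Notation half_log := (half_log bl).
Notation W := (2 ^ (bl + 3 + L)).

Let LL : L <= bl. Proof. by apply: log_le => //; case/andP: Lbl. Qed.

(** [W] dominates the length of the array at every level, so every pass takes time linear in [W]. *)
Lemma pass_cost_W d len g env M : small env -> len != base_var -> env len <= W ->
    exp_size g <= 300 ->
  cost w d env (pass d len g) M <= 700 * W.
Proof.
move=> [_ He] lD lW sg.
have vw : 2 ^ v < 2 ^ w by rewrite ltn_exp2l //; lia.
have W0 : 0 < W by rewrite expn_gt0.
apply: leq_trans (pass_cost _ _ _ (ltn_trans (He _ lD) vw)) _.
apply: (@leq_trans ((W + W) * 350)); last by clear -W0; lia.
by apply: leq_mul; lia.
Qed.

Lemma stage_cost sE g env M s m r : small env -> env 14 = m -> env 15 = r ->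
    s < v -> ev w env M sE = s -> exp_size sE <= 10 -> env 17 <= W ->
    exp_size g <= 300 ->
  cost w 20 env (stage_lets sE (pass 23 17 g)) M <= 800 * W.
Proof.
move=> He Em Er sv Es ss lW sg.
have -> : cost w 20 env (stage_lets sE (pass 23 17 g)) M =
    exp_size sE + 8 + cost w 23 (stage_env env s m r) (pass 23 17 g) M.
  exact: (congr1 snd (stage_run bl_gt0 Lbl bv ve ew (pass 23 17 g) He Em Er sv Es)).
have W0 : 0 < W by rewrite expn_gt0.
have := pass_cost_W 23 (g := g) M (small_stage_env He Em Er sv) (isT : 17 != base_var) lW sg.
by clear -ss W0; lia.
Qed.

Lemma fwd_level_cost env M l : small env -> env 1 = bl -> l < L -> env 10 = l ->
  cost w 11 env fwd_level M <= 4000 * (bl * W).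
Proof.
move=> He E1 lL E10.
have K0 := row_log_le bl l; have Ks := row_log_split bl l.
have Hh : half_log l <= bl.+1 by apply: leq_trans K0; rewrite Ks leq_addr.
set len := bl + 3 + l.
have lenv : len < v by rewrite /len; lia.
have lenW : 2 ^ len <= W by rewrite leq_exp2l // /len; lia.
have W0 : 0 < W by rewrite expn_gt0.
set body := Seq (pass 18 17 expand_exp)
  (For (Var 13) (stage_lets (Var 19 + Lit 1) (pass 23 17 fwd_exp))).
have -> : cost w 11 env fwd_level M = 31 + cost w 18 (level_env bl env l len) body M.
  refine (congr1 snd (@level_run _ _ _ _ _ bl_gt0 Lbl bv ve ew (Var 10)
    (Var 1 + Lit 3 + Var 11) body env M l len He E1 lL E10 isT _ _ isT lenv)).
    by clear -bv ve bl_gt0; move=> /=; lia.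
  by rewrite /= /level_env /upd /= E1.
have sl := small_level_env bl_gt0 Lbl bv ve ew He lL lenv.
set env' := level_env _ _ _ _ in sl *.
rewrite cost_Seq; set M1 := sem _ _ _ _ _.
have H1 := pass_cost_W 18 (g := expand_exp) M sl (isT : 17 != base_var) lenW isT.
have H2 : cost w 18 env' (For (Var 13) (stage_lets (Var 19 + Lit 1) (pass 23 17 fwd_exp))) M1 <=
    1 + 5 + half_log l * (800 * W + 4).
  apply: cost_For; [by [] | by apply: ltn_2pow; lia | ].
  move=> s M2 sh; set env2 := upd (upd env' 18 _) 19 _.
  have s2 : small env2.
    by apply: small_upd_lin => //; [lia|]; apply: small_upd_lin => //; lia.
  apply: (stage_cost (s := s.+1) s2 erefl erefl); [by lia | | by [] | by [] | by []].
  rewrite (ev_small_index ew _ s2); [exact: addn1 | by [] | by clear -bv ve bl_gt0; move=> /=; lia].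
apply: leq_trans (leq_add (leqnn 31) (leq_add H1 H2)) _.
have H3 : half_log l * (800 * W + 4) <= (2 * bl) * (804 * W).
  by apply: leq_mul; [lia | clear -W0; lia].
have H4 : W <= bl * W by rewrite leq_pmull.
rewrite mulnACA in H3.
by clear -H3 H4 W0; lia.
Qed.

Lemma inv_level_cost env M l' : small env -> env 1 = bl -> env 2 = L -> l' < L -> env 10 = l' ->
  cost w 11 env inv_level M <= 4000 * (bl * W).
Proof.
move=> He E1 E2 lL' E10; set l := L - l'.+1.
have lL : l < L by rewrite /l; lia.
have K0 := row_log_le bl l; have Ks := row_log_split bl l.
have Hh : half_log l <= bl.+1 by apply: leq_trans K0; rewrite Ks leq_addr.
set len := bl + 2 + l.
have lenv : len < v by rewrite /len; lia.
have lenW : 2 ^ len <= W by rewrite leq_exp2l // /len; lia.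
have W0 : 0 < W by rewrite expn_gt0.
set body := Seq (For (Var 13 + Lit 1) (stage_lets (Var 13 - Var 19) (pass 23 17 inv_exp)))
         (Let (Var 17 %/ Lit 2) (pass 19 18 reduce_exp)).
have ElE : ev w env M (Var 2 - (Var 10 + Lit 1))%exp = l.
  apply: ev_sub; [exact: E2 | | by lia | by apply: ltn_2pow; lia].
  rewrite (ev_small_index ew _ He); [ | by [] | by clear -bv ve bl_gt0; move=> /=; lia].
  by rewrite /= E10 addn1.
have -> : cost w 11 env inv_level M = 35 + cost w 18 (level_env bl env l len) body M.
  refine (congr1 snd (@level_run _ _ _ _ _ bl_gt0 Lbl bv ve ew _
    (Var 1 + Lit 2 + Var 11) body env M l len He E1 lL ElE isT _ _ isT lenv)).
    by clear -bv ve bl_gt0; move=> /=; lia.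
  by rewrite /= /level_env /upd /= E1.
have sl := small_level_env bl_gt0 Lbl bv ve ew He lL lenv.
set env' := level_env _ _ _ _ in sl *.
rewrite cost_Seq; set M1 := sem _ _ _ _ _.
have H2 : cost w 18 env' (For (Var 13 + Lit 1)
    (stage_lets (Var 13 - Var 19) (pass 23 17 inv_exp))) M <= 3 + 5 + (half_log l).+1 * (800 * W + 4).
  apply: cost_For; [ | by apply: ltn_2pow; lia | ].
    rewrite (ev_small_index ew _ sl); [exact: addn1 | by [] | by clear -bv ve bl_gt0; move=> /=; lia].
  move=> s M2 sh; set env2 := upd (upd env' 18 _) 19 _.
  have s2 : small env2.
    by apply: small_upd_lin => //; [lia|]; apply: small_upd_lin => //; lia.
  apply: (stage_cost (s := half_log l - s) s2 erefl erefl); [by lia | | by [] | by [] | by []].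
  by apply: (ev_sub (a := half_log l) (b := s)); [ | | lia | apply: ltn_2pow; lia].
have Ehalf : ev w env' M1 (Var 17 %/ Lit 2)%exp = 2 ^ len %/ 2.
  rewrite (ev_small_index ew _ sl); [by [] | by [] | by clear -bv ve bl_gt0; move=> /=; lia].
have halfW : 2 ^ len %/ 2 <= W by apply: leq_trans (leq_div _ _) lenW.
have s5 : small (upd env' 18 (2 ^ len %/ 2)).
  apply: small_env_upd => //; apply: leq_ltn_trans (leq_div _ _) _.
  by rewrite ltn_exp2l.
have H1 := pass_cost_W 19 (g := reduce_exp) (len := 18) M1 s5 isT halfW isT.
have -> : cost w 18 env' (Let (Var 17 %/ Lit 2) (pass 19 18 reduce_exp)) M1 =
    3 + cost w 19 (upd env' 18 (2 ^ len %/ 2)) (pass 19 18 reduce_exp) M1.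
  exact: (congr1 snd (run_Let 18 (pass 19 18 reduce_exp) Ehalf)).
apply: leq_trans (leq_add (leqnn 35) (leq_add H2 (leq_add (leqnn 3) H1))) _.
have H3 : (half_log l).+1 * (800 * W + 4) <= (3 * bl) * (804 * W).
  by apply: leq_mul; [lia | clear -W0; lia].
have H4 : W <= bl * W by rewrite leq_pmull.
rewrite mulnACA in H3.
by clear -H3 H4 W0; lia.
Qed.

Lemma convolution_cost env M : small env -> env 1 = bl -> env 2 = L ->
  cost w 9 env convolution M <= 3 * 3000 * (bl * bl * W).
Proof.
move=> He E1 E2.
have W0 : 0 < W by rewrite expn_gt0.
have Lw : L < 2 ^ w by apply: ltn_2pow; lia.
have senv l : l < L -> small (upd (upd env 9 L) 10 l).
  by move=> lL; apply: small_upd_lin => //; [lia|]; apply: small_upd_lin => //; lia.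
rewrite /convolution !cost_Seq; set M1 := sem _ _ _ _ M; set M2 := sem _ _ _ _ M1.
have H1 : cost w 9 env (For (Var 2) fwd_level) M <= 1 + 5 + L * (4000 * (bl * W) + 4).
  by apply: cost_For => // l M' lL; exact: (fwd_level_cost M' (senv _ lL) E1 lL erefl).
have H2 : cost w 9 env (For (Var 2) inv_level) M2 <= 1 + 5 + L * (4000 * (bl * W) + 4).
  by apply: cost_For => // l M' lL; exact: (inv_level_cost M' (senv _ lL) E1 E2 lL erefl).
have Eb : ev w env M1 (pow2 (Var 1 + Lit 1 + Var 2)) = 2 ^ (bl + 1 + L).
  apply: ev_shl1; last by lia.
  rewrite (ev_small_index ew _ He); [ | by [] | by clear -bv ve bl_gt0; move=> /=; lia].
  by rewrite /= E1 E2.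
have sb : small (upd env 9 (2 ^ (bl + 1 + L))) by apply: small_upd_exp => //; lia.
have lenW : 2 ^ (bl + 1 + L) <= W by rewrite leq_exp2l //; lia.
have H3 := pass_cost_W 10 (g := base_exp) (len := 9) M1 sb isT lenW isT.
have -> : cost w 9 env base_level M1 =
    7 + cost w 10 (upd env 9 (2 ^ (bl + 1 + L))) (pass 10 9 base_exp) M1.
  exact: (congr1 snd (run_Let 9 (pass 10 9 base_exp) Eb)).
apply: leq_trans (leq_add H1 (leq_add (leq_add (leqnn 7) H3) H2)) _.
(* [L] is only logarithmic in [bl]; replacing it by [bl] loses less than a factor [bl]. *)
have H4 : L * (4000 * (bl * W) + 4) <= bl * (4004 * (bl * W)).
  by apply: leq_mul; [exact: LL | clear -W0 bl_gt0; nia].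
have H5 : W <= bl * bl * W by rewrite leq_pmull // muln_gt0 bl_gt0.
rewrite mulnCA mulnA in H4.
by clear -H4 H5 W0; lia.
Qed.

End ConvolutionCost.


(** Dyadic blocks: the [2 ^ k] divisors from [2 ^ k] to [2 ^ k.+1 - 1] contribute at most [N]
    together. This bounds the number of pairs tried for products. *)
Lemma harmonic_sum N k : \sum_(i < 2 ^ k - 1) N %/ i.+1 <= k * N.
Proof.
elim: k => [|k IH]; first by rewrite subnn big_ord0.
have E : 2 ^ k.+1 - 1 = (2 ^ k - 1) + 2 ^ k.
  by rewrite expnS; have := expn_gt0 2 k; lia.
rewrite E big_split_ord /= mulSnr; apply: leq_add => //.
apply: leq_trans (_ : \sum_(i < 2 ^ k) N %/ 2 ^ k <= N); last first.
  by rewrite sum_nat_const card_ord mulnC leq_trunc_div.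
apply: leq_sum => i _; apply: leq_div2l; first by rewrite expn_gt0.
by have := expn_gt0 2 k; lia.
Qed.

Lemma harmonic_sum_lt N k : N < 2 ^ k -> \sum_(i < N) N %/ i.+1 <= k * N.
Proof.
move=> Nk; apply: leq_trans (harmonic_sum N k).
have E : 2 ^ k - 1 = N + (2 ^ k - 1 - N) by lia.
by rewrite E big_split_ord /= leq_addr.
Qed.

(** * Cost of a stage *)

Section StageCost.

Variables (w v e bl L N : nat).
Hypothesis (bl_gt0 : 0 < bl) (Lbl : 2 ^ L.-1 <= bl < 2 ^ L) (Nbl : N < 2 ^ bl).
Hypothesis (bv : 8 * bl <= v) (ve : 100 * v + 100 <= e) (ew : e.+2 <= w).

Notation small := (small_env v e).
Notation n := (2 ^ bl.+1).
Notation W := (2 ^ (bl + 3 + L)).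

Let W_gt0 : 0 < W. Proof. by rewrite expn_gt0. Qed.

Let N_le_W : N <= W.
Proof. by apply/ltnW/(ltn_exp2 Nbl); lia. Qed.

Let W_le : W <= bl * bl * W.
Proof. by rewrite leq_pmull // muln_gt0 bl_gt0. Qed.

Let N_lt_w : N < 2 ^ w.
Proof. by apply: ltn_exp2 Nbl _; lia. Qed.

Lemma sum_step_cost env M :
    small env -> env 0 = N -> env 1 = bl -> env 2 = L -> env 4 = n ->
  cost w 9 env sum_step M <= 3 * 3100 * (bl * bl * W).
Proof.
move=> He E0 E1 E2 E4; rewrite /sum_step.
rewrite (cost_Seq _ _ _ clear_cmd) (cost_Seq _ _ _ fill_cmd) (cost_Seq _ _ _ convolution).
set M1 := sem _ _ _ _ M; set M2 := sem _ _ _ _ M1; set M3 := sem _ _ _ _ M2.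
have nW : n + n <= W by rewrite addnn -mul2n -expnS leq_exp2l //; lia.
have H1 : cost w 9 env clear_cmd M <= 3 + 5 + (n + n) * (5 + 4).
  apply: cost_For => [||i M' _]; last by [].
    rewrite (ev_small_index ew _ He); [by rewrite /= E4 | by [] | by clear -ve; move=> /=; lia].
  by rewrite addnn -mul2n -expnS ltn_exp2l //; lia.
have H2 : cost w 9 env fill_cmd M1 <= 1 + 5 + N * (50 + 4).
  apply: cost_For => [||i M' _]; [exact: E0 | exact: N_lt_w | ].
  by apply: leq_trans (cost_static _ _ _ _ _) _.
have H3 := convolution_cost bl_gt0 Lbl bv ve ew M2 He E1 E2.
have H4 : cost w 9 env harvest_cmd M3 <= 1 + 5 + N * (50 + 4).
  apply: cost_For => [||i M' _]; [exact: E0 | exact: N_lt_w | ].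
  by apply: leq_trans (cost_static _ _ _ _ _) _.
apply: leq_trans (leq_add H1 (leq_add H2 (leq_add H3 H4))) _.
by move: nW W_gt0 N_le_W W_le; clear; lia.
Qed.

Lemma product_step_cost env M : small env -> env 0 = N ->
  cost w 7 env product_step M <= 100 * (bl * bl * W).
Proof.
move=> He E0.
have Nv : N < 2 ^ v by apply: ltn_exp2 Nbl _; lia.
have vw : 2 ^ v < 2 ^ w by rewrite ltn_exp2l //; lia.
have H : cost w 7 env product_step M <=
    1 + 5 + \sum_(i < N) (5 + 5 + N %/ i.+1 * (55 + 4) + 4).
  apply: (cost_For_sum (b := fun i => 5 + 5 + N %/ i.+1 * (55 + 4))) => [||i M' iN].
  - exact: E0.
  - exact: N_lt_w.
  have s1 := small_loop (d := 7) isT He Nv iN.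
  apply: cost_For => [||j M2 _].
  - rewrite (ev_small_index ew _ s1); [by rewrite /= /upd /= E0 addn1 | by [] | by clear -ve; move=> /=; lia].
  - by apply: leq_ltn_trans (leq_div _ _) N_lt_w.
  by apply: leq_trans (cost_static _ _ _ _ _) _.
apply: leq_trans H _; rewrite !big_split /= -big_distrl /= !sum_nat_const card_ord.
have := harmonic_sum_lt Nbl; set h := \sum_(_ < _) _ => Hh.
have NW : bl * N <= bl * bl * W.
  by rewrite -mulnA leq_mul2l (leq_trans N_le_W) ?orbT // leq_pmull.
by move: Hh NW W_gt0 N_le_W W_le; clear; lia.
Qed.

Lemma stage_cost_bound env M s :
    small env -> env 0 = N -> env 1 = bl -> env 2 = L -> env 4 = n -> env 6 = s ->
    s < 3 * bl ->
  cost w 7 env stage M <= 7 * 4100 * (bl * (bl * bl * W)).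
Proof.
move=> He E0 E1 E2 E4 E6 sb; rewrite /stage cost_Seq; set M1 := sem _ _ _ _ _.
have H1 : cost w 7 env (For (Var 6 + Lit 1)%exp sum_step) M <=
    3 + 5 + s.+1 * (3 * 3100 * (bl * bl * W) + 4).
  apply: cost_For => [||i M' iN].
  - rewrite (ev_small_index ew _ He); [by rewrite /= E6 addn1 | by [] | by clear -ve; move=> /=; lia].
  - by apply: ltn_2pow; lia.
  apply: sum_step_cost; [ | exact: E0 | exact: E1 | exact: E2 | exact: E4].
  by apply: small_upd_lin => //; [lia|]; apply: small_upd_lin => //; lia.
have H2 := product_step_cost M1 He E0.
apply: leq_trans (leq_add H1 H2) _.
have WX := W_le; set X := bl * bl * W in WX *.
have H3 : s.+1 * (3 * 3100 * X + 4) <= (3 * bl) * (3 * 3102 * X).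
  by apply: leq_mul => //; move: W_gt0 WX; clear; lia.
have H4 : X <= bl * X by rewrite leq_pmull.
rewrite mulnACA in H3.
by move: H3 H4 W_gt0 WX; clear; lia.
Qed.

End StageCost.

Lemma bit_length_cmd_cost w d x env M : env x < 2 ^ w ->
  cost w d env (bit_length_cmd d x) M <= 9 + env x * 24.
Proof.
move=> xw; rewrite /bit_length_cmd cost_Seq; set M1 := sem _ _ _ _ _.
have H : cost w d env (For (Var x) (IfLt (pow2 (Fetch (Lit 0))) (Var d.+1 + Lit 2)
       (Store (Lit 0) (Fetch (Lit 0) + Lit 1)))) M1 <= 1 + 5 + env x * (20 + 4).
  apply: cost_For => // i M' _.
  by apply: leq_trans (cost_static _ _ _ _ _) _.
by move: H; rewrite [cost _ _ _ (Store _ _) _]/=; lia.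
Qed.

(** The 32 is the loss in [W <= 32 * (N * bl)], from rounding to powers of two; [24 * 4000] covers
    the [3 * 7 * 4100] of the stages and the lower-order terms. *)
Definition time_factor : nat := 32 * (24 * 4000).

(** One factor [bit_length N] each for the stages, the splits of a stage, the levels of a
    convolution, the passes of a level, and the growth of the data over the levels. *)
Definition time_bound (N : nat) : nat := time_factor * (N * bit_length N ^ 5).

Lemma main_cost w N : 0 < N -> 1010 * bit_length N <= w ->
  cost w 1 (upd (fun=> 0) 0 N) main_cmd (fun=> 0) <= time_bound N.
Proof.
move=> N0 blw; have [M [HM _]] := main_run N0 blw.
have -> : cost w 1 (upd (fun=> 0) 0 N) main_cmd (fun=> 0) =
    cost w 1 (upd (fun=> 0) 0 N) (bit_length_cmd 1 0) (fun=> 0) +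
    cost w 2 (upd (upd (fun=> 0) 0 N) 1 (bit_length N)) (bit_length_cmd 2 1)
      (sem w 1 (upd (fun=> 0) 0 N) (bit_length_cmd 1 0) (fun=> 0)) + 14 +
    cost w 5 (main_env N) stages_cmd M.
  exact: (congr1 snd HM).
have b0 : 0 < bit_length N by [].
have Nb : N < 2 ^ bit_length N by case/andP: (bit_length_bounds N0).
have Nb2 : 2 ^ (bit_length N).-1 <= N by case/andP: (bit_length_bounds N0).
have Lb := bit_length_bounds b0.
have He := main_env_small N0 blw.
rewrite /time_bound /time_factor.
set bl := bit_length N in blw b0 Nb Nb2 Lb He *; set L := bit_length bl in Lb *.
have ve : 100 * (8 * bl) + 100 <= 1000 * bl by lia.
have ew : (1000 * bl).+2 <= w by lia.
have blw' : bl < w by lia.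
have lin k : k < w -> k < 2 ^ w by apply: ltn_2pow.
have H1 := @bit_length_cmd_cost w 1 0 (upd (fun=> 0) 0 N) (fun=> 0)
  (ltn_exp2 Nb (ltnW blw')).
have H2 := @bit_length_cmd_cost w 2 1 (upd (upd (fun=> 0) 0 N) 1 bl)
  (sem w 1 (upd (fun=> 0) 0 N) (bit_length_cmd 1 0) (fun=> 0)) (lin _ blw').
set X := bl * bl * 2 ^ (bl + 3 + L).
have H3 : cost w 5 (main_env N) stages_cmd M <= 12 + 3 * bl * (7 * 4100 * (bl * X) + 4).
  rewrite /stages_cmd cost_Seq; set M1 := sem _ _ _ _ _.
  have H : cost w 5 (main_env N) (For (Lit 3 * Var 1) stage) M1 <=
      3 + 5 + 3 * bl * (7 * 4100 * (bl * X) + 4).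
    apply: cost_For => [||s M' sb].
    - rewrite (ev_small_index ew _ He); [by [] | by [] | by clear -b0; move=> /=; lia].
    - by apply: lin; lia.
    have s5 : small_env (8 * bl) (1000 * bl) (upd (upd (main_env N) 5 (3 * bl)) 6 s).
      apply: small_upd_lin; [by [] | by lia | ].
      by apply: small_upd_lin; [by [] | by lia | ].
    exact: (stage_cost_bound b0 Lb Nb (leqnn _) ve ew M' s5 erefl erefl erefl erefl erefl sb).
  by move: H; rewrite [cost _ _ _ (Store _ _) _]/=; clear; lia.
set c1 := cost _ _ _ (bit_length_cmd 1 0) _ in H1 *.
set c2 := cost _ _ _ (bit_length_cmd 2 1) _ in H2 *.
set c3 := cost _ _ _ stages_cmd _ in H3 *.
have {}H1 : c1 <= 9 + N * 24 := H1; have {}H2 : c2 <= 9 + bl * 24 := H2.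
clearbody c1 c2 c3; clear HM He ve ew lin blw blw' w M.
have XW : X <= 32 * (N * bl ^ 3).
  have W1 : 2 ^ (bl + 3 + L) <= 8 * (2 * N) * (2 * bl).
    rewrite !expnD -[2 ^ 3]/8 [_ * 8]mulnC; apply: leq_mul; first apply: leq_mul => //.
      by rewrite -(prednK b0) expnS leq_mul2l Nb2 orbT.
    have L0 : 0 < L by [].
    by rewrite -(prednK L0) expnS leq_mul2l; case/andP: Lb => -> _; rewrite orbT.
  apply: leq_trans (leq_mul (leqnn _) W1) _.
  by rewrite !expnS expn0; clear; nia.
have B1 : bl * (bl * X) <= 32 * (N * bl ^ 5).
  rewrite mulnA; apply: leq_trans (leq_mul (leqnn _) XW) _.
  by rewrite !expnS expn0; clear; nia.
have B2 : bl <= bl * (bl * X).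
  by rewrite leq_pmulr // !muln_gt0 b0 expn_gt0.
have B3 : N <= N * bl ^ 5 by rewrite leq_pmulr // expn_gt0 b0.
have E3 : 3 * bl * (7 * 4100 * (bl * X) + 4) = 3 * (7 * 4100 * (bl * (bl * X))) + 12 * bl.
  by clearbody X; clear; nia.
rewrite {}E3 in H3.
by clear -H1 H2 H3 B1 B2 B3 N0; lia.
Qed.

Theorem theorem6 :
  exists (P : program) (T : nat -> nat),
    computes_complexities_in P T /\ O_N_polylog T.
Proof.
exists (compile 1 0 main_cmd), time_bound; split.
  exists 1010 => // N w N0 blw.
  have [s [Hs Ms]] := @compile_exec w main_cmd N isT.
  exists (cost w 1 (upd (fun=> 0) 0 N) main_cmd (fun=> 0)), s; split.
  - exact: Hs.
  - exact: main_cost.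
  - by move=> n nN; rewrite Ms; apply: main_spec.
(* For [N >= 2] the bit length is at most twice the logarithm, and the fifth power turns this into
   the factor 32. *)
exists 5, (time_factor * 32), 2 => N N2; rewrite /time_bound.
move: time_factor => c; rewrite -mulnA leq_mul2l mulnCA leq_mul2l -[32]/(2 ^ 5) -expnMn leq_exp2r //.
have l1 : 0 < trunc_log 2 N by rewrite trunc_log_gt0.
apply/orP; right; apply/orP; right.
by rewrite /bit_length; lia.
Qed.
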